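(* Let $d\in\{3,4,\dots\}\cup\{\infty\}$ and let $K\colon\mathbb{R}^d\times\mathbb{R}^d\to\mathbb{C}$ be a continuous isotropic positive definite kernel, with unique associated kernels $\alpha_n^d$, $n\in\mathbb{N}_0$, on $[0,\infty)$ as defined in the context. The following assertions are equivalent: (i) $K$ is strictly positive definite (on $\mathbb{R}^d$). (ii) $\alpha_0^d(0,0)>0$, and for any $m\in\mathbb{N}$, distinct $r_1,\dots,r_m\in(0,\infty)$ and $c\in\mathbb{C}^m\setminus\{0\}$ the set $$\Bigl\{n\in\mathbb{N}_0 : \sum_{i,j=1}^m c_i\overline{c_j}\,\alpha_n^d(r_i,r_j)>0\Bigr\}$$ contains infinitely many even and infinitely many odd integers. (iii) $\alpha_0^d(0,0)>0$, and for each $\gamma\ge 0$ the kernels $$\alpha_\gamma^e(r,s):=\sum_{n\in\mathbb{N}_0,\,2n\ge\gamma}\alpha_{2n}^d(r,s),\qquad \alpha_\gamma^o(r,s):=\sum_{n\in\mathbb{N}_0,\,2n+1\ge\gamma}\alpha_{2n+1}^d(r,s)$$ are both strictly positive definite on $(0,\infty)$. Furthermore, the following condition is sufficient for strict positive definiteness of $K$: (iv) $\alpha_0^d(0,0)>0$, and $\alpha_n^d$ is strictly positive definite on $(0,\infty)$ for infinitely many even and infinitely many odd $n\in\mathbb{N}_0$. If $\alpha_0^d(0,0)=0$ but all other requirements in (ii) (respectively in (iii), respectively in (iv)) are satisfied, then $K$ is strictly positive definite on $\mathbb{R}^d\setminus\{0\}$. Conditions (ii) and (iii), each without the requirement $\alpha_0^d(0,0)>0$,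 are also necessary for strict positive definiteness of $K$ on $\mathbb{R}^d\setminus\{0\}$.
   Context: For $d=\infty$, $\mathbb{R}^\infty:=\ell^2$ is the real Hilbert space of square summable real sequences. $O(d)$ is the group of (bijective) linear isometries of $\mathbb{R}^d$. A positive definite kernel on a set $X$ is a function $K\colon X\times X\to\mathbb{C}$ such that $\sum_{i,j=1}^m c_i\overline{c_j}K(x_i,x_j)\ge 0$ for all $m\in\mathbb{N}$, $x_1,\dots,x_m\in X$, $c\in\mathbb{C}^m$. It is strictly positive definite on a subset $A\subseteq X$ if the inequality is strict whenever $x_1,\dots,x_m\in A$ are distinct and $c\neq 0$. A kernel $K$ on $\mathbb{R}^d$ is isotropic if $K(Ux,Uy)=K(x,y)$ for all $U\in O(d)$ and $x,y\in\mathbb{R}^d$. Let $\lambda=\frac{d-2}{2}$. Normalized Gegenbauer polynomials: for $0<\lambda<\infty$, $\hat C_n^\lambda(t)=C_n^\lambda(t)/C_n^\lambda(1)$ where $\sum_{n\ge0}z^nC_n^\lambda(t)=(1-2tz+z^2)^{-\lambda}$ ($|z|<1$, $t\in[-1,1]$); for $\lambda=\infty$, $\hat C_n^\infty(t)=t^n$ (with $0^0=1$). Associated kernels $\alpha_n^d$: every continuous isotropic positive definite kernel $K$ on $\mathbb{R}^d$ can be written as $K(x,y)=\sum_{n=0}^\infty\alpha_n^d(\|x\|,\|y\|)\,\hat C_n^\lambda(\langle\frac{x}{\|x\|},\frac{y}{\|y\|}\rangle)$ for $x,y\neq0$, and $K(x,y)=\alpha_0^d(\|x\|,\|y\|)$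 if $x=0$ or $y=0$, where $\alpha_n^d\colon[0,\infty)^2\to\mathbb{C}$ are the unique continuous positive definite kernels on $[0,\infty)$ satisfying this together with: (a) for every $r\ge0$ there is a neighborhood $U_r\subset[0,\infty)$ of $r$ with $\sup_{s\in U_r}\sum_{n\ge N}\alpha_n^d(s,s)\to0$ as $N\to\infty$; (b) $\alpha_n^d(r,0)=\alpha_n^d(0,r)=0$ for all $n\ge1$, $r\ge0$. *)

(* Defs.v *)
From HB Require Import structures.
From mathcomp Require Import all_boot all_order all_algebra.
From mathcomp Require Import all_classical all_reals all_analysis.
From mathcomp Require Import complex.
From mathcomp Require Import ring lra.

Set Implicit Arguments.
Unset Strict Implicit.
Unset Printing Implicit Defensive.

Import Order.TTheory GRing.Theory Num.Theory.
Import numFieldNormedType.Exports.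

Local Open Scope classical_set_scope.
Local Open Scope ring_scope.

(* The library equips abstract numFieldTypes, but not R[i] itself, with the   *)
(* metric topology of the modulus.                                            *)
#[non_forgetful_inheritance]
HB.instance Definition _ (R : rcfType) := NormedModule.copy R[i] (R[i])^o.

HB.mixin Record NormedModule_hasDot (R : realType) V of NormedModule R V := {
  dot : V -> V -> R;
  dotC : forall x y, dot x y = dot y x;
  dotDl : forall x y z, dot (x + y) z = dot x z + dot y z;
  dotZl : forall (a : R) x y, dot (a *: x) y = a * dot x y;
  dotxx : forall x, dot x x = `|x| ^+ 2
}.

#[short(type="innerProdType")]
HB.structure Definition InnerProd (R : realType) :=
  {V of NormedModule R V & NormedModule_hasDot R V}.

HB.factory Record Lmodule_hasDot (R : realType) V of GRing.Lmodule R V := {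
  idot : V -> V -> R;
  idotC : forall x y, idot x y = idot y x;
  idotDl : forall x y z, idot (x + y) z = idot x z + idot y z;
  idotZl : forall (a : R) x y, idot (a *: x) y = a * idot x y;
  idot_ge0 : forall x, 0 <= idot x x;
  idot_eq0 : forall x, idot x x = 0 -> x = 0
}.

HB.builders Context R V of Lmodule_hasDot R V.

Let nrm (x : V) : R := Num.sqrt (idot x x).

Let idotDr x y z : idot x (y + z) = idot x y + idot x z.
Proof. by rewrite idotC idotDl !(idotC x). Qed.

Let idotZr a x y : idot x (a *: y) = a * idot x y.
Proof. by rewrite idotC idotZl (idotC x). Qed.

Let nrmE x : nrm x ^+ 2 = idot x x.
Proof. by rewrite sqr_sqrtr // idot_ge0. Qed.

Let nrm0 x : nrm x = 0 -> x = 0.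
Proof. by move=> x0; apply: idot_eq0; rewrite -nrmE x0 expr0n. Qed.

Let nrmZ a x : nrm (a *: x) = `|a| * nrm x.
Proof.
by rewrite /nrm idotZl idotZr mulrA -expr2 sqrtrM ?sqr_ge0// sqrtr_sqr.
Qed.

Let cauchy_schwarz x y : idot x y <= nrm x * nrm y.
Proof.
have [x0|xn0] := eqVneq (nrm x) 0.
  by rewrite x0 mul0r (nrm0 x0) -(scale0r 0) idotZl mul0r.
have [y0|yn0] := eqVneq (nrm y) 0.
  by rewrite y0 mulr0 (nrm0 y0) -(scale0r 0) idotZr mul0r.
have xgt0 : 0 < nrm x by rewrite lt_neqAle eq_sym xn0 sqrtr_ge0.
have ygt0 : 0 < nrm y by rewrite lt_neqAle eq_sym yn0 sqrtr_ge0.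
have := idot_ge0 (nrm y *: x + (- nrm x) *: y).
rewrite !idotDl !idotDr !idotZl !idotZr (idotC y x) -!nrmE.
set a := nrm x; set b := nrm y; set s := idot x y.
have -> : b * (b * a ^+ 2) + b * (- a * s) + (- a * (b * s) + - a * (- a * b ^+ 2))
   = (a * b) * (2 * (a * b - s)) by ring.
rewrite pmulr_rge0 ?mulr_gt0// pmulr_rge0 ?ltr0n//.
by rewrite subr_ge0.
Qed.

Let nrmD x y : nrm (x + y) <= nrm x + nrm y.
Proof.
rewrite -(@ler_pXn2r _ 2)// ?nnegrE ?addr_ge0 ?sqrtr_ge0//.
rewrite nrmE idotDl !idotDr (idotC y x) -!nrmE sqrrD.
have := cauchy_schwarz x y; lra.
Qed.

HB.instance Definition _ := Lmodule_isNormed.Build R V nrmD nrmZ nrm0.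

Let idotxx x : idot x x = `|x| ^+ 2.
Proof. by rewrite -nrmE. Qed.

HB.instance Definition _ :=
  NormedModule_hasDot.Build R V idotC idotDl idotZl idotxx.

HB.end.

(* A fresh name for row vectors: the library norm on 'rV is the sup norm.     *)
Definition euclid (R : realType) (d : nat) : Type := 'rV[R]_d.

Section euclid.
Variables (R : realType) (d : nat).

HB.instance Definition _ := GRing.Lmodule.on (euclid R d).

Definition euclid_dot (x y : euclid R d) : R := \sum_(i < d) x 0 i * y 0 i.

Let euclid_dotC x y : euclid_dot x y = euclid_dot y x.
Proof. by apply: eq_bigr => i _; rewrite mulrC. Qed.

Let euclid_dotDl x y z :
  euclid_dot (x + y) z = euclid_dot x z + euclid_dot y z.
Proof. by rewrite -big_split; apply: eq_bigr => i _; rewrite mxE mulrDl. Qed.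

Let euclid_dotZl a x y : euclid_dot (a *: x) y = a * euclid_dot x y.
Proof. by rewrite /euclid_dot mulr_sumr; apply: eq_bigr => i _; rewrite mxE mulrA. Qed.

Let euclid_dot_ge0 x : 0 <= euclid_dot x x.
Proof. by apply: sumr_ge0 => i _; rewrite -expr2 sqr_ge0. Qed.

Let euclid_dot_eq0 x : euclid_dot x x = 0 -> x = 0.
Proof.
move=> /eqP; rewrite psumr_eq0; last by move=> i _; rewrite -expr2 sqr_ge0.
move=> /allP x0; apply/rowP => i; rewrite mxE; apply/eqP.
by have := x0 i (mem_index_enum _); rewrite /= mulf_eq0 orbb.
Qed.

HB.instance Definition _ := Lmodule_hasDot.Build R (euclid R d)
  euclid_dotC euclid_dotDl euclid_dotZl euclid_dot_ge0 euclid_dot_eq0.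

End euclid.

Definition square_summable (R : realType) : {pred nat -> R} :=
  [pred x : nat -> R | `[< cvgn (series (fun n => x n ^+ 2)) >]].

Record ell2 (R : realType) := Ell2 {
  ell2_val :> nat -> R;
  ell2P : ell2_val \in @square_summable R
}.

Section ell2.
Variable R : realType.

Lemma square_summableP (x : nat -> R) :
  reflect (cvgn (series (fun n => x n ^+ 2))) (x \in @square_summable R).
Proof. by rewrite inE; apply: asboolP. Qed.

Let summable_mul (x y : nat -> R) :
  x \in @square_summable R -> y \in @square_summable R ->
  cvgn (series (fun n => x n * y n)).
Proof.
move=> /square_summableP xs /square_summableP ys.
apply: normed_cvg.
apply: (@series_le_cvg _ _ ((fun n => x n ^+ 2) + (fun n => y n ^+ 2))).
- by move=> n; rewrite normr_ge0.
- by move=> n; rewrite addr_ge0 ?sqr_ge0.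
- move=> n; rewrite /= normrM fctE -(real_normK (num_real (x n))).
  rewrite -(real_normK (num_real (y n))).
  have := sqr_ge0 (`|x n| - `|y n|).
  have := mulr_ge0 (normr_ge0 (x n)) (normr_ge0 (y n)).
  rewrite sqrrB; lra.
- exact: is_cvg_seriesD.
Qed.

Let square_summable_submod : submod_closed (@square_summable R).
Proof.
split.
  apply/square_summableP; rewrite (_ : series _ = cst 0); first exact: is_cvg_cst.
  by apply/funext => n; rewrite /series /= big1// => i _; rewrite expr0n.
move=> a x y xs ys; apply/square_summableP.
have xy := summable_mul xs ys.
move: xs ys => /square_summableP xs /square_summableP ys.
rewrite (_ : (fun _ => _) = (a ^+ 2) *: (fun n => x n ^+ 2)
   + ((2 * a) *: (fun n => x n * y n) + (fun n => y n ^+ 2))).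
  apply: is_cvg_seriesD; first exact: is_cvg_seriesZ.
  by apply: is_cvg_seriesD => //; exact: is_cvg_seriesZ.
apply/funext => n.
change ((a * x n + y n) ^+ 2
  = a ^+ 2 * x n ^+ 2 + (2 * a * (x n * y n) + y n ^+ 2)); ring.
Qed.

HB.instance Definition _ := GRing.isSubmodClosed.Build R (nat -> R)
  (@square_summable R) square_summable_submod.
HB.instance Definition _ := [isSub for @ell2_val R].
HB.instance Definition _ := [Choice of ell2 R by <:].
HB.instance Definition _ := [SubChoice_isSubLmodule of ell2 R by <:].

Definition ell2_dot (x y : ell2 R) : R := limn (series (fun n => x n * y n)).

Let ell2_dotC x y : ell2_dot x y = ell2_dot y x.
Proof.
by rewrite /ell2_dot; under [in LHS]eq_fun do rewrite mulrC.
Qed.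

Let ell2_dotDl x y z : ell2_dot (x + y) z = ell2_dot x z + ell2_dot y z.
Proof.
rewrite /ell2_dot -lim_seriesD; [|exact: summable_mul (ell2P _) (ell2P _)..].
by congr (limn (series _)); apply/funext => n; rewrite -mulrDl.
Qed.

Let ell2_dotZl a x y : ell2_dot (a *: x) y = a * ell2_dot x y.
Proof.
rewrite /ell2_dot -[RHS]lim_seriesZ; last exact: summable_mul (ell2P _) (ell2P _).
by congr (limn (series _)); apply/funext => n; rewrite -mulrA.
Qed.

Let ell2_dot_term (x : ell2 R) n : x n * x n <= ell2_dot x x.
Proof.
have nd : {homo series (fun n => x n * x n) : m n / (m <= n)%N >-> m <= n}.
  apply: nondecreasing_series => k _ _; rewrite -expr2; exact: sqr_ge0.
have := nondecreasing_cvgn_le nd (summable_mul (ell2P x) (ell2P x)) n.+1.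
apply: le_trans; rewrite /series /= big_nat_recr//= lerDr.
by apply: sumr_ge0 => i _; rewrite -expr2 sqr_ge0.
Qed.

Let ell2_dot_ge0 x : 0 <= ell2_dot x x.
Proof. by apply: le_trans (ell2_dot_term x 0); rewrite -expr2 sqr_ge0. Qed.

Let ell2_dot_eq0 x : ell2_dot x x = 0 -> x = 0.
Proof.
move=> x0; apply/val_inj/funext => n /=; apply/eqP.
by rewrite -sqrf_eq0 expr2 eq_le -expr2 sqr_ge0 andbT -x0 expr2 ell2_dot_term.
Qed.

HB.instance Definition _ := Lmodule_hasDot.Build R (ell2 R)
  ell2_dotC ell2_dotDl ell2_dotZl ell2_dot_ge0 ell2_dot_eq0.

End ell2.

Inductive dimension := Findim of nat | Infdim.

Definition dim_ge3 (d : dimension) : bool :=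
  if d is Findim k then (3 <= k)%N else true.

Definition Rd (R : realType) (d : dimension) : innerProdType R :=
  if d is Findim k then euclid R k else ell2 R.

Section kernels.
Variable R : realType.

Definition qform (X : Type) (K : X -> X -> R[i]) (m : nat)
    (x : 'I_m -> X) (c : 'I_m -> R[i]) : R[i] :=
  \sum_(i < m) \sum_(j < m) c i * (c j)^* * K (x i) (x j).

Definition posdef_on (X : Type) (A : set X) (K : X -> X -> R[i]) : Prop :=
  forall (m : nat) (x : 'I_m -> X) (c : 'I_m -> R[i]),
    (forall i, A (x i)) -> 0 <= qform K x c.

Definition strict_posdef_on (X : Type) (A : set X) (K : X -> X -> R[i]) : Prop :=
  forall (m : nat) (x : 'I_m -> X) (c : 'I_m -> R[i]),
    (forall i, A (x i)) -> injective x -> (exists i, c i != 0) ->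
    0 < qform K x c.

Definition isotropic (V : innerProdType R) (K : V -> V -> R[i]) : Prop :=
  forall U : {linear V -> V}, bijective U -> (forall x, `|U x| = `|x|) ->
    forall x y, K (U x) (U y) = K x y.

(* The coefficients at t of the generating function, unique where they exist  *)
(* (in particular for -1 <= t <= 1, the only values of t used below).         *)
Definition gegenbauer (l : R) (n : nat) (t : R) : R :=
  get [set C : nat -> R | forall z : R, `|z| < 1 ->
    pseries C z @ \oo --> (1 - 2 * t * z + z ^+ 2) `^ (- l)] n.

Definition gegenbauer_hat (l : \bar R) (n : nat) (t : R) : R :=
  if l is l'%:E then gegenbauer l' n t / gegenbauer l' n 1 else t ^+ n.

Definition lambda (d : dimension) : \bar R :=
  if d is Findim k then ((k%:R - 2) / 2)%:E else +oo%E.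

(* Kernels on [0, +oo[ are represented by functions on R x R of which only    *)
(* the restriction to [0, +oo[ x [0, +oo[ matters. In associated_tail,        *)
(* alpha n s s is real and nonnegative, so taking Re loses nothing.             *)
Record associated_kernels (d : dimension) (K : Rd R d -> Rd R d -> R[i])
    (alpha : nat -> R -> R -> R[i]) : Prop := AssociatedKernels {
  associated_continuous : forall n,
    {within `[0, +oo[ `*` `[0, +oo[,
      continuous (fun p : R * R => alpha n p.1 p.2)};
  associated_posdef : forall n, posdef_on `[0, +oo[ (alpha n);
  associated_expansion : forall x y : Rd R d, x != 0 -> y != 0 ->
    series (fun n => alpha n `|x| `|y| *
      (gegenbauer_hat (lambda d) n
        (dot (`|x|^-1 *: x) (`|y|^-1 *: y)))%:C%C) @ \oo --> K x y;
  associated_origin : forall x y : Rd R d, x = 0 \/ y = 0 ->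
    K x y = alpha 0%N `|x| `|y|;
  associated_tail : forall r : R, 0 <= r ->
    exists U : set R,
      [/\ within `[0, +oo[ (nbhs r) U, U `<=` `[0, +oo[ &
        (fun N => ereal_sup [set (\sum_(N <= n <oo) (complex.Re (alpha n s s))%:E)%E
                            | s in U]) @ \oo --> 0%E];
  associated_zero : forall (n : nat) (r : R), (1 <= n)%N -> 0 <= r ->
    alpha n r 0 = 0 /\ alpha n 0 r = 0
}.

Section conditions.
Variable alpha : nat -> R -> R -> R[i].

Definition infinitely_many_even_odd (S : set nat) : Prop :=
  infinite_set (S `&` [set n | ~~ odd n]) /\ infinite_set (S `&` [set n | odd n]).

Definition alpha_even (gamma : R) (r s : R) : R[i] :=
  limn (fun N => \sum_(0 <= n < N | gamma <= (2 * n)%:R) alpha (2 * n)%N r s).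

Definition alpha_odd (gamma : R) (r s : R) : R[i] :=
  limn (fun N => \sum_(0 <= n < N | gamma <= (2 * n + 1)%:R)
                   alpha (2 * n + 1)%N r s).

Definition forms_positive_infinitely_often : Prop :=
  forall (m : nat) (r : 'I_m -> R) (c : 'I_m -> R[i]),
    (forall i, 0 < r i) -> injective r -> (exists i, c i != 0) ->
    infinitely_many_even_odd [set n | 0 < qform (alpha n) r c].

Definition tails_strict_posdef : Prop :=
  forall gamma : R, 0 <= gamma ->
    strict_posdef_on `]0, +oo[ (alpha_even gamma) /\
    strict_posdef_on `]0, +oo[ (alpha_odd gamma).

Definition infinitely_often_strict_posdef : Prop :=
  infinitely_many_even_odd [set n | strict_posdef_on `]0, +oo[ (alpha n)].

End conditions.

End kernels.

Arguments lambda {R} d.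

(* Main.v *)
(** Restricted to finitely many points, the expansion of the kernel is a series of
positive semidefinite forms: by the addition theorem the Gegenbauer kernels are
Gram kernels on the sphere. The addition theorem is obtained from the Fischer
inner product on polynomials: zonal harmonic polynomials are orthogonal to the
multiples of the squared norm, so the product of two of them is, up to a positive
constant, an evaluation.

Sufficiency. Group the points by lines through the origin. For two different
lines the normalised Gegenbauer polynomials tend to 0 as the degree grows, so by
diagonal dominance the form of large degree n is at least half the sum of the
forms of alpha_n of the single lines. On the line [R xi] the points [r xi] and
[- r xi] contribute the sum or the difference of their coefficients, according to
the parity of n, and one of the two is nonzero.

Necessity. If the form of alpha_n in (r_i), (c_i) is positive for finitely many n
of some parity only, take the points [+- r_i xi_k] with the coefficients
[c_i w_k], symmetrised according to that parity, where the xi_k lie on a circle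
and the w_k annihilate the finitely many finite rank kernels left over. All the
terms of the expansion vanish.

Conditions (ii) and (iii) are compared by summing the forms of one parity. *)
From HB Require Import structures.
Require Import Defs.
From mathcomp Require Import all_boot all_order all_algebra.
From mathcomp Require Import all_classical all_reals all_analysis.
From mathcomp Require Import complex ring lra zify.
From mathcomp Require Import -(notations) ssrcomplements mpoly.

Set Implicit Arguments.
Unset Strict Implicit.
Unset Printing Implicit Defensive.

Import Order.TTheory GRing.Theory Num.Theory.
Import numFieldNormedType.Exports.

Local Open Scope classical_set_scope.
Local Open Scope ring_scope.

(** * Harmonic polynomials and the Fischer inner product *)

Section ThreeTerm.
Variables (A : comNzRingType) (mu : nat -> A) (s u : A).

(** Kept over any commutative ring, so that it serves for polynomials in several variables, for
    their values and, with [mu = 0], for plain powers. The argument [u] homogenises the recurrence;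
    its coefficients make every value at [s = u = 1] equal to 1. *)
Fixpoint three_term_pair (n : nat) : A * A :=
  if n is n'.+1 then
    let: (a, b) := three_term_pair n' in
    (b, (1 + mu n') * s * b - mu n' * u * a)
  else (1, s).

Definition three_term n := (three_term_pair n).1.

Lemma three_term0 : three_term 0 = 1. Proof. by []. Qed.

Lemma three_term1 : three_term 1 = s. Proof. by []. Qed.

Lemma three_termSS n : three_term n.+2 =
  (1 + mu n) * s * three_term n.+1 - mu n * u * three_term n.
Proof. by rewrite /three_term /=; case: (three_term_pair n). Qed.

End ThreeTerm.

Lemma nat_ind2 (P : nat -> Prop) :
  P 0%N -> P 1%N -> (forall n, P n -> P n.+1 -> P n.+2) -> forall n, P n.
Proof.
move=> P0 P1 PS n; suff [] : P n /\ P n.+1 by [].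
by elim: n => [|n [Pn PSn]]; split => //; apply: PS.
Qed.

Lemma three_term_rmorph (A B : comNzRingType) (f : {rmorphism A -> B})
    (mu : nat -> A) (s u : A) n :
  f (three_term mu s u n) = three_term (f \o mu) (f s) (f u) n.
Proof.
elim/nat_ind2: n => [||n IH0 IH1]; rewrite ?three_term0 ?three_term1 ?rmorph1//.
by rewrite !three_termSS rmorphB !rmorphM rmorphD rmorph1 IH0 IH1.
Qed.

Lemma three_termN (A : comNzRingType) (mu : nat -> A) (s u : A) n :
  three_term mu (- s) u n = (-1) ^+ n * three_term mu s u n.
Proof.
elim/nat_ind2: n => [||n IH0 IH1]; first by rewrite expr0 mul1r.
  by rewrite expr1 mulN1r.
by rewrite !three_termSS IH0 IH1 !exprS; ring.
Qed.

Lemma three_term_at1 (A : comNzRingType) (mu : nat -> A) n :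
  three_term mu 1 1 n = 1.
Proof.
elim/nat_ind2: n => [||n IH0 IH1] //.
by rewrite three_termSS IH0 IH1; ring.
Qed.

Lemma three_term_mu0 (A : comNzRingType) (s u : A) n :
  three_term (fun=> 0) s u n = s ^+ n.
Proof.
elim/nat_ind2: n => [||n IH0 IH1] //.
by rewrite three_termSS IH1 !exprS; ring.
Qed.

Section Fischer.
Variables (R : realType) (k : nat).
Implicit Types (p q : mpoly k R) (i : 'I_k) (v : 'I_k -> R).

Definition mono_sum (phi : multinom k -> R) p : R :=
  \sum_(m <- msupp p) mcoeff m p * phi m.

(** The support of a sum is not determined by the supports of the summands; linearity is therefore
    proved with one set of monomials common to all polynomials involved. *)
Lemma mono_sumE phi p N : (msize p <= N)%N ->
  mono_sum phi p = \sum_(m : bmultinom k N) mcoeff (bmnm m) p * phi (bmnm m).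
Proof.
move=> lt_pN; rewrite /mono_sum (big_mksub (bmultinom k N)) //=; first last.
- by move=> x /msize_mdeg_lt /leq_trans; apply.
- by rewrite msupp_uniq.
by rewrite big_rmcond //= => m; move/memN_msupp_eq0 ->; rewrite mul0r.
Qed.

Lemma mono_sumD phi p q : mono_sum phi (p + q) = mono_sum phi p + mono_sum phi q.
Proof.
set N := (maxn (msize (p + q)) (maxn (msize p) (msize q))).
rewrite !(@mono_sumE _ _ N) ?leq_max ?leqnn ?orbT//.
by rewrite -big_split; apply: eq_bigr => m _; rewrite mcoeffD mulrDl.
Qed.

Lemma mono_sumZ phi a p : mono_sum phi (a *: p) = a * mono_sum phi p.
Proof.
set N := (maxn (msize (a *: p)) (msize p)).
rewrite !(@mono_sumE _ _ N) ?leq_max ?leqnn ?orbT//.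
by rewrite mulr_sumr; apply: eq_bigr => m _; rewrite mcoeffZ mulrA.
Qed.

Lemma mono_sum0 phi : mono_sum phi 0 = 0.
Proof. by rewrite -(scale0r (0 : mpoly k R)) mono_sumZ mul0r. Qed.

Lemma mono_sumX phi m : mono_sum phi (mpolyX R m) = phi m.
Proof. by rewrite /mono_sum msuppX big_seq1 mcoeffX eqxx mul1r. Qed.

Definition mfact (m : multinom k) : R := (\prod_(i < k) (m i)`!)%:R.

Lemma mfact_ge0 m : 0 <= mfact m. Proof. exact: ler0n. Qed.

(** Monomials are orthogonal with squares [m!]. These weights make multiplication by a variable
    adjoint to the partial derivative, hence [square_norm] adjoint to [laplacian]. *)
Definition fischer p q : R := mono_sum (fun m => mfact m * mcoeff m q) p.

Lemma fischerDl p p' q : fischer (p + p') q = fischer p q + fischer p' q.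
Proof. exact: mono_sumD. Qed.

Lemma fischerZl a p q : fischer (a *: p) q = a * fischer p q.
Proof. exact: mono_sumZ. Qed.

Lemma fischer_suml (I : Type) (r : seq I) (F : I -> mpoly k R) q :
  fischer (\sum_(j <- r) F j) q = \sum_(j <- r) fischer (F j) q.
Proof.
elim: r => [|j r IH]; first by rewrite !big_nil /fischer mono_sum0.
by rewrite !big_cons fischerDl IH.
Qed.

Lemma fischerE p q N : (msize p <= N)%N -> fischer p q =
  \sum_(m : bmultinom k N)
    mfact (bmnm m) * (mcoeff (bmnm m) p * mcoeff (bmnm m) q).
Proof.
by move=> /mono_sumE pN; rewrite /fischer pN; apply: eq_bigr => m _;
  rewrite mulrCA.
Qed.

Lemma fischerC p q : fischer p q = fischer q p.
Proof.
set N := maxn (msize p) (msize q).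
rewrite (@fischerE p q N) ?leq_maxl// (@fischerE q p N) ?leq_maxr//.
by apply: eq_bigr => m _; rewrite [mcoeff _ p * _]mulrC.
Qed.

Lemma fischerZr a p q : fischer p (a *: q) = a * fischer p q.
Proof. by rewrite fischerC fischerZl (fischerC p). Qed.

Lemma fischer_sumr (I : Type) (r : seq I) (F : I -> mpoly k R) p :
  fischer p (\sum_(j <- r) F j) = \sum_(j <- r) fischer p (F j).
Proof. by rewrite fischerC fischer_suml; apply: eq_bigr => j _; rewrite fischerC. Qed.

Lemma mfactD1 m i : mfact (mnm_add m (mnm1 i)) = (m i).+1%:R * mfact m.
Proof.
rewrite /mfact (bigD1 i)//= [in RHS](bigD1 i)//= mnmDE mnm1E eqxx addn1 factS.
rewrite -mulnA natrM; congr (_ * (_ * _)%N%:R); apply: eq_bigr => j ji.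
by rewrite mnmDE mnm1E eq_sym (negbTE ji) addn0.
Qed.

Lemma fischer_adjoint i p q :
  fischer (mpolyX R (mnm1 i) * p) q = fischer p (mderiv i q).
Proof.
elim/mpolyind: p => [|c m p _ _ IH].
  by rewrite mulr0 /fischer !mono_sum0.
rewrite mulrDr -scalerAr -mpolyXD fischerDl fischerZl [RHS]fischerDl fischerZl IH.
congr (_ * _ + _); rewrite /fischer !mono_sumX mcoeff_mderiv.
rewrite addmC mfactD1 -mulr_natl; ring.
Qed.

Definition linear_form v : mpoly k R := \sum_i v i *: mpolyX R (mnm1 i).

Definition square_norm : mpoly k R := \sum_i mpolyX R (mnm1 i) * mpolyX R (mnm1 i).

Definition dir_deriv v q : mpoly k R := \sum_i v i *: mderiv i q.

Definition laplacian q : mpoly k R := \sum_i mderiv i (mderiv i q).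

Definition euler q : mpoly k R := \sum_i mpolyX R (mnm1 i) * mderiv i q.

Lemma mderivXU i j : mderiv i (mpolyX R (mnm1 j)) = (j == i)%:R.
Proof.
rewrite mderivX mnm1E; case: eqP => [->|_]; last by rewrite scale0r.
by rewrite scale1r (_ : mnm_sub _ _ = mnm0) ?mpolyX0//; apply/mnmP => l;
  rewrite mnmBE mnm0E subnn.
Qed.

Lemma mderiv_linear_form i v : mderiv i (linear_form v) = mpolyC k (v i).
Proof.
rewrite raddf_sum (bigD1 i)//= mderivZ mderivXU eqxx big1 ?addr0 => [|j ji].
  by rewrite -mul_mpolyC mulr1.
by rewrite mderivZ mderivXU (negbTE ji) scaler0.
Qed.

Lemma mderiv_square_norm i : mderiv i square_norm = 2%:R * mpolyX R (mnm1 i).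
Proof.
rewrite raddf_sum (bigD1 i)//= mderivM mderivXU eqxx mul1r mulr1 big1 ?addr0 => [|j ji].
  by rewrite mulr2n mulrDl mul1r.
by rewrite mderivM mderivXU (negbTE ji) mul0r mulr0 addr0.
Qed.

Lemma fischer_linear_form v p q :
  fischer (linear_form v * p) q = fischer p (dir_deriv v q).
Proof.
rewrite mulr_suml fischer_suml fischer_sumr; apply: eq_bigr => i _.
by rewrite -scalerAl fischerZl fischer_adjoint fischerZr.
Qed.

Lemma fischer_square_norm p q :
  fischer (square_norm * p) q = fischer p (laplacian q).
Proof.
rewrite mulr_suml fischer_suml fischer_sumr; apply: eq_bigr => i _.
by rewrite -mulrA !fischer_adjoint.
Qed.

Lemma dir_derivM v p q :
  dir_deriv v (p * q) = dir_deriv v p * q + p * dir_deriv v q.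
Proof.
rewrite mulr_suml mulr_sumr -big_split; apply: eq_bigr => i _.
by rewrite mderivM scalerDr scalerAl scalerAr.
Qed.

Lemma eulerM p q : euler (p * q) = euler p * q + p * euler q.
Proof.
rewrite mulr_suml mulr_sumr -big_split; apply: eq_bigr => i _.
rewrite mderivM /=; ring.
Qed.

Lemma euler_linear_form v : euler (linear_form v) = linear_form v.
Proof.
by apply: eq_bigr => i _; rewrite mderiv_linear_form mulrC mul_mpolyC.
Qed.

Lemma euler_square_norm : euler square_norm = 2%:R * square_norm.
Proof.
by rewrite mulr_sumr; apply: eq_bigr => i _; rewrite mderiv_square_norm mulrCA.
Qed.

Lemma dir_deriv_linear_form v w :
  dir_deriv v (linear_form w) = mpolyC k (\sum_i v i * w i).
Proof.
rewrite [RHS]raddf_sum; apply: eq_bigr => i _.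
by rewrite mderiv_linear_form -mul_mpolyC -mpolyCM.
Qed.

Lemma dir_deriv_square_norm v :
  dir_deriv v square_norm = 2%:R * linear_form v.
Proof.
by rewrite mulr_sumr; apply: eq_bigr => i _; rewrite mderiv_square_norm scalerAr.
Qed.

Lemma laplacianMl v p :
  laplacian (linear_form v * p) = 2%:R * dir_deriv v p + linear_form v * laplacian p.
Proof.
rewrite !mulr_sumr -big_split; apply: eq_bigr => i _ /=.
rewrite mderivM mderivD !mderivM mderiv_linear_form. rewrite mderivC mul0r add0r.
rewrite -mul_mpolyC; ring.
Qed.

Lemma laplacianMq p :
  laplacian (square_norm * p) =
  (2 * k)%:R * p + 4%:R * euler p + square_norm * laplacian p.
Proof.
have -> : (2 * k)%:R * p = \sum_(i < k) 2%:R * p.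
  by rewrite sumr_const card_ord -[RHS]mulr_natl mulrA -natrM mulnC.
rewrite [4%:R * _]mulr_sumr [square_norm * laplacian p]mulr_sumr -!big_split.
apply: eq_bigr => i _ /=.
rewrite mderivM mderivD !mderivM mderiv_square_norm mderivM mderivXU eqxx.
rewrite [mderiv i 2%:R](_ : _ = 0); last first.
  by rewrite -(rmorph_nat (@mpolyC k R)) mderivC.
rewrite /=; ring.
Qed.

(* The commutator of [dir_deriv v] and [euler] is [dir_deriv v]. *)
Lemma euler_dir_deriv v q n :
  euler q = n.+1%:R * q -> euler (dir_deriv v q) = n%:R * dir_deriv v q.
Proof.
move=> qn.
have : dir_deriv v (euler q) = dir_deriv v q + euler (dir_deriv v q).
  rewrite [LHS](eq_bigr (fun j => v j *: mderiv j q +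
     \sum_i mpolyX R (mnm1 i) * (v j *: mderiv i (mderiv j q)))); last first.
    move=> j _; rewrite (_ : mderiv j (euler q) =
        mderiv j q + \sum_i mpolyX R (mnm1 i) * mderiv i (mderiv j q)).
      rewrite scalerDr; congr (_ + _); rewrite scaler_sumr; apply: eq_bigr => i _.
      by rewrite scalerAr.
    rewrite raddf_sum (eq_bigr (fun i => (i == j)%:R * mderiv i q
        + mpolyX R (mnm1 i) * mderiv i (mderiv j q))); last first.
      by move=> i _ /=; rewrite mderivM mderivXU (mderiv_comm i j).
    rewrite big_split /= (bigD1 j)//= eqxx mul1r big1 ?addr0// => i ij.
    by rewrite (negbTE ij) mul0r.
  rewrite big_split /= exchange_big /=; congr (_ + _); apply: eq_bigr => i _.
  rewrite /dir_deriv raddf_sum mulr_sumr; apply: eq_bigr => j _.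
  by rewrite /= mderivZ.
rewrite qn (_ : dir_deriv v (_ * q) = n.+1%:R * dir_deriv v q); last first.
  rewrite mulr_sumr; apply: eq_bigr => i _.
  by rewrite !mulr_natl mderivMn scalerMnr.
by rewrite -natr1 mulrDl mul1r addrC => /addrI ->.
Qed.

(** The Euler operator is diagonal on monomials, so [euler q = n%:R * q] expresses homogeneity of
    degree [n]. *)
Lemma mcoeff_euler m q : mcoeff m (euler q) = (mdeg m)%:R * mcoeff m q.
Proof.
rewrite raddf_sum mdegE natr_sum mulr_suml; apply: eq_bigr => i _ /=.
rewrite mulrC; case: (posnP (m i)) => [m0|mp].
  rewrite m0 mul0r; apply/eqP; rewrite mcoeff_eq0.
  apply/negP; rewrite (perm_mem (msuppMX _ _)) => /mapP[m' _ mE].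
  by move: m0; rewrite mE mnmDE mnm1E eqxx.
have mE : m = mnm_add (mnm_sub m (mnm1 i)) (mnm1 i).
  by apply/mnmP => j; rewrite mnmDE mnmBE mnm1E; case: eqP => [<-|]; lia.
rewrite {1}mE addmC mcoeffMX mcoeff_mderiv -mE mnmBE mnm1E eqxx mulr_natl.
by rewrite subn1 prednK.
Qed.

Lemma meval_dir_deriv v q : meval v (dir_deriv v q) = meval v (euler q).
Proof.
rewrite !raddf_sum; apply: eq_bigr => i _ /=.
by rewrite mevalZ mevalM mevalXU.
Qed.

(** Moving one linear factor across the product leaves the derivative along [v], whose value at [v]
    is the degree times that of [q] by Euler's identity. The degrees multiply to the factorial. *)
Lemma fischer_linear_formX v q n : euler q = n%:R * q ->
  fischer (linear_form v ^+ n) q = n`!%:R * meval v q.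
Proof.
elim: n q => [|n IH] q qn.
  rewrite expr0 mul1r -mpolyX0 /fischer mono_sumX /mfact big1 ?mul1r => [|i _].
    rewrite {2}(_ : q = mpolyC k (mcoeff mnm0 q)) ?mevalC//.
    apply/mpolyP => m; rewrite mcoeffC; case: eqVneq => [->|m0]; first by rewrite mulr1.
    rewrite mulr0; apply/eqP; have /eqP := congr1 (mcoeff m) qn.
    by rewrite mcoeff_euler mul0r mcoeff0 mulf_eq0 pnatr_eq0 mdeg_eq0 (negbTE m0).
  by rewrite mnm0E.
rewrite exprS fischer_linear_form IH ?(euler_dir_deriv _ qn)//.
rewrite meval_dir_deriv qn factS natrM mevalM rmorph_nat; ring.
Qed.

End Fischer.

(** Here [D] is the dimension minus 2, twice the Gegenbauer index. Multiplied by [n + 1 + D], the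
    recurrence becomes the classical one for the polynomials normalised at 1. *)
Definition gegen_mu (R : realType) (D n : nat) : R := n.+1%:R / (n.+1 + D)%:R.

(* [gegen D n] is the Gegenbauer polynomial of index [D / 2] divided by its
   value at 1, see [gegenbauer_hatE]. *)
Definition gegen (R : realType) (D n : nat) (t : R) : R :=
  three_term (@gegen_mu R D) t 1 n.

Lemma gegen_mu_ge0 (R : realType) D n : 0 <= gegen_mu R D n.
Proof. by rewrite divr_ge0. Qed.

Lemma gegen_muE (R : realType) D n :
  (n.+1 + D)%:R * gegen_mu R D n = n.+1%:R.
Proof. by rewrite /gegen_mu mulrC divfK// pnatr_eq0. Qed.

Lemma raddf_natM (A B : pzRingType) (f : {additive A -> B}) n (x : A) :
  f (n%:R * x) = n%:R * f x.
Proof. by rewrite !mulr_natl raddfMn. Qed.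

(** * Zonal harmonic polynomials and the addition theorem *)

Section ZonalHarmonics.
Variables (R : realType) (D : nat).
Local Notation k := D.+2.
Implicit Types (v w : 'I_k -> R) (p q : mpoly k R).

Fact dir_deriv_is_zmod_morphism v : zmod_morphism (@dir_deriv R k v).
Proof.
by move=> p q; rewrite /dir_deriv -sumrB; apply: eq_bigr => i _;
  rewrite mderivB scalerBr.
Qed.

Fact euler_is_zmod_morphism : zmod_morphism (@euler R k).
Proof.
by move=> p q; rewrite /euler -sumrB; apply: eq_bigr => i _;
  rewrite mderivB mulrBr.
Qed.

Fact laplacian_is_zmod_morphism : zmod_morphism (@laplacian R k).
Proof.
by move=> p q; rewrite /laplacian -sumrB; apply: eq_bigr => i _;
  rewrite !mderivB.
Qed.

HB.instance Definition _ v := GRing.isZmodMorphism.Build _ _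
  (@dir_deriv R k v) (dir_deriv_is_zmod_morphism v).
HB.instance Definition _ := GRing.isZmodMorphism.Build _ _
  (@euler R k) euler_is_zmod_morphism.
HB.instance Definition _ := GRing.isZmodMorphism.Build _ _
  (@laplacian R k) laplacian_is_zmod_morphism.

(* For a unit vector [v], the homogeneous harmonic polynomial whose value at a
   unit vector [w] is [gegen D n (v . w)]. *)
Definition zonal v n : mpoly k R :=
  three_term (fun m => mpolyC k (gegen_mu R D m)) (linear_form v) (square_norm R k) n.

Lemma zonal0 v : zonal v 0 = 1. Proof. by []. Qed.

Lemma zonal1 v : zonal v 1 = linear_form v. Proof. by []. Qed.

Lemma mpoly_natI n p q : n.+1%:R * p = n.+1%:R * q -> p = q.
Proof.
by rewrite -(rmorph_nat (@mpolyC k R)) !mul_mpolyC => /scalerI; apply;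
  rewrite pnatr_eq0.
Qed.

Lemma zonal_rec v n : (n + D).+1%:R * zonal v n.+2 =
  (2 * n.+1 + D)%:R * (linear_form v * zonal v n.+1)
  - n.+1%:R * (square_norm R k * zonal v n).
Proof.
have muE : (n + D).+1%:R * mpolyC k (gegen_mu R D n) = n.+1%:R.
  rewrite -!(rmorph_nat (@mpolyC k R)) -mpolyCM; congr (mpolyC k _).
  exact: gegen_muE.
rewrite /zonal three_termSS -!/(zonal v _).
rewrite [LHS](_ : _ = ((n + D).+1%:R + (n + D).+1%:R * mpolyC k (gegen_mu R D n)) *
   (linear_form v * zonal v n.+1) - (n + D).+1%:R * mpolyC k (gegen_mu R D n) *
   (square_norm R k * zonal v n)); last by ring.
rewrite muE; ring.
Qed.

(** Eliminates the lower term in the derivative of [zonal]. For [n = 0] its coefficient is zero, so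
    the value of [n.-1] is immaterial. *)
Lemma zonal_rec_pred v n : n%:R * (square_norm R k * zonal v n.-1) =
  (2 * n + D)%:R * (linear_form v * zonal v n) - (n + D)%:R * zonal v n.+1.
Proof.
case: n => [|n]; first by rewrite zonal0 zonal1; ring.
by rewrite addSn zonal_rec /=; ring.
Qed.

Lemma euler_zonal v n : euler (zonal v n) = n%:R * zonal v n.
Proof.
elim/nat_ind2: n => [||n IH0 IH1].
- rewrite zonal0 mul0r /euler big1// => i _.
  by rewrite -(rmorph1 (@mpolyC k R)) mderivC mulr0.
- by rewrite zonal1 euler_linear_form mul1r.
apply: (@mpoly_natI (n + D)).
rewrite [RHS]mulrCA zonal_rec -raddf_natM zonal_rec.
rewrite raddfB !raddf_natM /= !eulerM IH0 IH1.
rewrite euler_linear_form euler_square_norm; ring.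
Qed.

Lemma dir_deriv_zonal v n : \sum_i v i * v i = 1 ->
  dir_deriv v (zonal v n) = n%:R * zonal v n.-1.
Proof.
move=> v1; elim/nat_ind2: n => [||n IH0 IH1].
- rewrite zonal0 mul0r /dir_deriv big1// => i _.
  by rewrite -(rmorph1 (@mpolyC k R)) mderivC scaler0.
- by rewrite zonal1 dir_deriv_linear_form v1 rmorph1 mul1r.
apply: (@mpoly_natI (n + D)).
rewrite -raddf_natM zonal_rec.
rewrite raddfB !raddf_natM /= !dir_derivM IH0 IH1.
rewrite dir_deriv_linear_form v1 rmorph1 dir_deriv_square_norm.
rewrite [square_norm R k * (n%:R * _)]mulrCA zonal_rec_pred /=; ring.
Qed.

(** By the product rules the two terms of the recurrence contribute [2 (n + 1) (2 n + 2 + D)] and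
    [(n + 1) (2 k + 4 n)] times [zonal v n]; they cancel because the number of variables is
    [k = D + 2]. *)
Lemma laplacian_zonal v n : \sum_i v i * v i = 1 -> laplacian (zonal v n) = 0.
Proof.
move=> v1; elim/nat_ind2: n => [||n IH0 IH1].
- rewrite zonal0 /laplacian big1// => i _.
  by rewrite -(rmorph1 (@mpolyC k R)) mderivC mderiv0.
- by rewrite zonal1 /laplacian big1// => i _; rewrite mderiv_linear_form mderivC.
apply: (@mpoly_natI (n + D)).
rewrite -raddf_natM zonal_rec.
rewrite raddfB !raddf_natM /= laplacianMl laplacianMq IH0 IH1.
rewrite (dir_deriv_zonal _ v1) euler_zonal /=; ring.
Qed.

(** Setting [u = 0] discards the multiples of [square_norm] and leaves the coefficient of the [n]-th
    power of the linear form. *)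
Definition zonal_lead n : R := three_term (@gegen_mu R D) 1 0 n.

Lemma zonal_lead_gt0 n : 0 < zonal_lead n.
Proof.
rewrite /zonal_lead; elim/nat_ind2: n => [||n _ IH] //.
rewrite three_termSS mulr0 mul0r subr0 mulr1 mulr_gt0//.
by rewrite ltr_wpDr ?gegen_mu_ge0.
Qed.

Lemma zonal_leadE v n : exists r,
  zonal v n = zonal_lead n *: linear_form v ^+ n + square_norm R k * r.
Proof.
elim/nat_ind2: n => [||n [r0 IH0] [r1 IH1]].
- by exists 0; rewrite zonal0 /zonal_lead expr0 scale1r mulr0 addr0.
- by exists 0; rewrite zonal1 /zonal_lead expr1 scale1r mulr0 addr0.
exists ((1 + mpolyC k (gegen_mu R D n)) * linear_form v * r1
        - mpolyC k (gegen_mu R D n) * zonal v n).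
rewrite /zonal three_termSS -!/(zonal v _) IH1.
rewrite {2}/zonal_lead three_termSS mulr0 mul0r subr0 mulr1 -/(zonal_lead _).
rewrite -!mul_mpolyC [mpolyC k ((1 + _) * _)]mpolyCM mpolyCD mpolyC1 !exprS; ring.
Qed.

Lemma meval_linear_form v w : meval w (linear_form v) = \sum_i v i * w i.
Proof. by rewrite raddf_sum; apply: eq_bigr => i _ /=; rewrite mevalZ mevalXU. Qed.

Lemma meval_zonal v w n : \sum_i w i * w i = 1 ->
  meval w (zonal v n) = gegen D n (\sum_i v i * w i).
Proof.
move=> w1; rewrite /zonal three_term_rmorph /= meval_linear_form.
rewrite (_ : meval w (square_norm R k) = 1); last first.
  by rewrite -w1 raddf_sum; apply: eq_bigr => i _ /=; rewrite mevalM mevalXU.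
by congr three_term; apply/funext => m /=; rewrite mevalC.
Qed.

(** Modulo [square_norm] the first factor is a multiple of a power of a linear form. The multiples
    of [square_norm] are orthogonal to the harmonic second factor, and the power acts as evaluation
    at [v]. *)
Lemma fischer_zonal v w n : \sum_i v i * v i = 1 -> \sum_i w i * w i = 1 ->
  fischer (zonal v n) (zonal w n) =
  zonal_lead n * n`!%:R * gegen D n (\sum_i v i * w i).
Proof.
move=> v1 w1; have [r rE] := zonal_leadE v n.
rewrite {1}rE fischerDl fischerZl fischer_square_norm laplacian_zonal//.
rewrite [fischer r 0]fischerC [fischer 0 r]mono_sum0 addr0.
rewrite fischer_linear_formX ?euler_zonal//.
rewrite meval_zonal// mulrA; congr (_ * gegen _ _ _).
by apply: eq_bigr => i _; rewrite mulrC.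
Qed.

(* Addition theorem, with the coefficients of the zonal polynomials instead of
   an orthonormal basis of spherical harmonics. *)
Lemma gegen_gram (m : nat) (v : 'I_m -> 'I_k -> R) n :
  (forall i, \sum_l v i l * v i l = 1) ->
  exists (I : finType) (phi : I -> 'I_m -> R),
    forall i j, gegen D n (\sum_l v i l * v j l) = \sum_a phi a i * phi a j.
Proof.
move=> v1; pose N := \max_(i < m) msize (zonal (v i) n).
pose c := zonal_lead n * n`!%:R.
have c_gt0 : 0 < c by rewrite mulr_gt0 ?zonal_lead_gt0// ltr0n fact_gt0.
exists (bmultinom k N), (fun a i =>
  Num.sqrt (mfact R (bmnm a) / c) * mcoeff (bmnm a) (zonal (v i) n)) => i j.
have /(congr1 ( *%R c^-1)) := fischer_zonal n (v1 i) (v1 j).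
rewrite mulKf ?gt_eqF// => <-; rewrite (@fischerE _ _ _ _ N); last first.
  exact: (@leq_bigmax _ (fun i => msize (zonal (v i) n)) i).
rewrite mulr_sumr; apply: eq_bigr => a _.
have w_ge0 : 0 <= mfact R (bmnm a) / c by rewrite divr_ge0 ?mfact_ge0// ltW.
by rewrite [RHS]mulrACA -expr2 sqr_sqrtr// [LHS]mulrA [c^-1 * _]mulrC.
Qed.

End ZonalHarmonics.

(** * Decay of normalised Gegenbauer polynomials *)

Section GegenDecay.
Variables (R : realType) (D : nat).
Local Notation h := (@gegen R D).
Local Notation mu := (@gegen_mu R D).

Lemma gegen0 t : h 0 t = 1. Proof. by []. Qed.

Lemma gegen1 t : h 1 t = t. Proof. by []. Qed.

Lemma gegenSS n t : h n.+2 t = (1 + mu n) * t * h n.+1 t - mu n * h n t.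
Proof. by rewrite /gegen three_termSS mulr1. Qed.

Lemma gegenN n t : h n (- t) = (-1) ^+ n * h n t.
Proof. exact: three_termN. Qed.

Lemma gegen_at1 n : h n 1 = 1.
Proof. exact: three_term_at1. Qed.

Lemma gegen_mu_le1 n : mu n <= 1.
Proof. by rewrite ler_pdivrMr ?ltr0n ?addSn// mul1r ler_nat; lia. Qed.

Lemma gegen_mu_homo n : mu n <= mu n.+1.
Proof.
rewrite ler_pdivrMr ?ltr0n ?addSn// mulrAC ler_pdivlMr ?ltr0n ?addSn//.
by rewrite -!natrM ler_nat; nia.
Qed.

(* The quadratic form [a ^ 2 - 2 t a b + b ^ 2] at consecutive values of the
   recurrence; it is positive definite for [t ^ 2 < 1]. *)
Definition gegen_energy t n := (h n t - t * h n.+1 t) ^+ 2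
  + (1 - t ^+ 2) * h n.+1 t ^+ 2.

Local Notation E := gegen_energy.

Lemma gegen_energyS t n :
  E t n.+1 = E t n - (1 - mu n ^+ 2) * (h n t - t * h n.+1 t) ^+ 2.
Proof. by rewrite /gegen_energy gegenSS; ring. Qed.

Lemma gegen_energy_ge0 t n : t ^+ 2 <= 1 -> 0 <= E t n.
Proof.
by move=> t1; rewrite addr_ge0 ?sqr_ge0// mulr_ge0 ?sqr_ge0// subr_ge0.
Qed.

Lemma gegen_mu_sqr_le1 n : mu n ^+ 2 <= 1.
Proof. by rewrite expr_le1 ?gegen_mu_ge0 ?gegen_mu_le1. Qed.

Lemma gegen_energy_homo t m n : (m <= n)%N -> E t n <= E t m.
Proof.
move=> mn; rewrite -(subnKC mn); elim: (n - m)%N => [|j IH]; first by rewrite addn0.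
rewrite addnS gegen_energyS; apply: le_trans IH; rewrite gerBl.
by rewrite mulr_ge0 ?sqr_ge0// subr_ge0 gegen_mu_sqr_le1.
Qed.

(** One step lowers the energy only through [h n t - t * h n.+1 t], which may vanish. Two
    consecutive quantities of this kind, [a] and [b], determine [h n.+1 t] and so bound the energy;
    hence the double step. *)
Lemma gegen_energy_drop t n : t ^+ 2 < 1 ->
  (1 - mu n.+1) * (1 - t ^+ 2) / 3 * E t n <= E t n - E t n.+2.
Proof.
move=> t1; set a := h n t - t * h n.+1 t; set b := h n.+1 t - t * h n.+2 t.
have key : (1 - t ^+ 2) / 3 * E t n <= a ^+ 2 + b ^+ 2.
  have bE : (1 - t ^+ 2) * h n.+1 t = b - t * mu n * a.
    by rewrite /b /a gegenSS; ring.
  have -> : (1 - t ^+ 2) / 3 * E t n =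
      ((1 - t ^+ 2) * a ^+ 2 + (b - t * mu n * a) ^+ 2) / 3.
    by rewrite -bE /gegen_energy -/a; ring.
  have := sqr_ge0 (b + t * mu n * a).
  have : (t * mu n) ^+ 2 <= 1.
    by rewrite exprMn mulr_ile1 ?sqr_ge0 ?gegen_mu_sqr_le1// ltW.
  have := sqr_ge0 t; have := sqr_ge0 a; have := sqr_ge0 b.
  nra.
have mu0 := gegen_mu_ge0 R D n.
have mu1 := gegen_mu_ge0 R D n.+1.
have mul1 := gegen_mu_le1 n.+1.
have muh := gegen_mu_homo n.
have -> : E t n - E t n.+2 = (1 - mu n ^+ 2) * a ^+ 2 + (1 - mu n.+1 ^+ 2) * b ^+ 2.
  by rewrite !gegen_energyS -/a -/b; ring.
have := sqr_ge0 a; have := sqr_ge0 b => b0 a0.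
apply: (@le_trans _ _ ((1 - mu n.+1) * (a ^+ 2 + b ^+ 2))).
  by rewrite -!mulrA ler_wpM2l ?subr_ge0// mulrA.
by rewrite mulrDr lerD// ler_wpM2r//; nra.
Qed.

(** For [t ^+ 2 < 1] the energy starts at [1 - t ^+ 2] and dominates that same factor times the
    square of [h]; the endpoints follow by parity. *)
Lemma gegen_le1 t n : t ^+ 2 <= 1 -> `|h n t| <= 1.
Proof.
rewrite le_eqVlt => /orP[|t1].
  rewrite sqrf_eq1 => /orP[/eqP->|/eqP->]; rewrite ?gegenN gegen_at1 ?normr1//.
  by rewrite mulr1 normrX normrN1 expr1n.
case: n => [|n]; first by rewrite gegen0 normr1.
rewrite -(@expr_le1 _ 2)// real_normK ?num_real//.
have t0 : 0 < 1 - t ^+ 2 by rewrite subr_gt0.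
rewrite -(ler_pM2l t0) mulr1.
have E0 : E t 0 = 1 - t ^+ 2 by rewrite /gegen_energy gegen0 gegen1; ring.
rewrite -E0; apply: le_trans (gegen_energy_homo t (leq0n n)).
by rewrite E0 lerDr sqr_ge0.
Qed.

Hypothesis D_gt0 : (0 < D)%N.

(* If the energy stayed above [e], each double step would decrease it by at
   least a constant times [e / n], contradicting the divergence of the harmonic
   series. *)
Lemma gegen_energy_cvg0 t e : t ^+ 2 < 1 -> 0 < e ->
  exists N, forall n, (N <= n)%N -> E t n < e.
Proof.
move=> t1 e0; apply: contrapT => noN.
have Ee n : e <= E t n.
  rewrite leNgt; apply/negP => En; apply: noN; exists n => p np.
  exact: le_lt_trans (gegen_energy_homo t np) En.
apply: (@dvg_harmonic R).
have t0 : 0 < 1 - t ^+ 2 by rewrite subr_gt0.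
(* Since [1 - mu n.+1] is [D / (n + 2 + D)], which is at least [1 / ((D + 2) (n + 1))], a double
   step costs at least [c / (n + 1)]. *)
pose c := (1 - t ^+ 2) / 3 / D.+2%:R * e.
have c0 : 0 < c by rewrite !mulr_gt0// invr_gt0.
apply: nondecreasing_is_cvgn.
  by apply/nondecreasing_seqP => n; rewrite /series /= big_nat_recr//= lerDl.
exists ((E t 0 + E t 1) / c) => _ [n _ <-].
rewrite ler_pdivlMr// mulrC.
have : c * series harmonic n <= (E t 0 + E t 1) - (E t n + E t n.+1).
  elim: n => [|n IH]; first by rewrite /series /= big_geq// mulr0 subrr.
  rewrite /series /= big_nat_recr//= mulrDr.
  suff : c * n.+1%:R^-1 <= E t n - E t n.+2.
    move: IH; rewrite /series /=.
    by move: (c * \sum_(0 <= _ < _) _) (c / _) => x y; lra.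
  apply: le_trans (gegen_energy_drop n t1).
  rewrite /c mulrAC ler_pM ?Ee ?(ltW e0)//.
    by rewrite mulr_ge0// ?divr_ge0 ?ler0n ?(ltW t0).
  have -> : 1 - mu n.+1 = D%:R / (n.+2 + D)%:R.
    rewrite /gegen_mu -[X in X - _](@divff _ (n.+2 + D)%:R) ?pnatr_eq0//.
    by rewrite -mulrBl -natrB ?leq_addr// addKn.
  have le_frac : D.+2%:R^-1 / n.+1%:R <= D%:R / (n.+2 + D)%:R :> R.
    rewrite -invfM ler_pdivlMr ?ltr0n// ler_pdivrMl ?mulr_gt0//.
    by rewrite -!natrM ler_nat; nia.
  rewrite [leRHS](_ : _ = (1 - t ^+ 2) / 3 * (D%:R / (n.+2 + D)%:R)); last by ring.
  by rewrite -[leLHS]mulrA ler_wpM2l// divr_ge0// ltW.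
have := @gegen_energy_ge0 t n (ltW t1); have := @gegen_energy_ge0 t n.+1 (ltW t1); lra.
Qed.

Lemma gegen_cvg0 t e : t ^+ 2 < 1 -> 0 < e ->
  exists N, forall n, (N <= n)%N -> `|h n t| <= e.
Proof.
move=> t1 e0; have t0 : 0 < 1 - t ^+ 2 by rewrite subr_gt0.
have e0' : 0 < (1 - t ^+ 2) * e ^+ 2 by rewrite mulr_gt0// exprn_gt0.
have [N EN] := gegen_energy_cvg0 t1 e0'.
exists N.+1 => -[//|n] Nn; rewrite -(@ler_pXn2r _ 2) ?nnegrE ?(ltW e0)//.
rewrite real_normK ?num_real// -(ler_pM2l t0).
by apply: le_trans (ltW (EN n Nn)); rewrite lerDr sqr_ge0.
Qed.

End GegenDecay.

(** * The generating function *)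

(** The left side is one term of the binomial expansion of [((1 - p) + p) ^+ (n + D)]. It keeps
    coefficients of polynomial growth bounded after multiplication by powers of a number below 1. *)
Lemma binomial_term_le1 (R : realType) (n D : nat) (p : R) : 0 <= p <= 1 ->
  'C(n + D, n)%:R * p ^+ n * (1 - p) ^+ D <= 1.
Proof.
move=> /andP[p0 p1]; have q0 : 0 <= 1 - p by rewrite subr_ge0.
have pE : ((1 - p) + p) ^+ (n + D) = 1 by rewrite subrK expr1n.
rewrite -[leRHS]pE [leRHS]exprDn.
have nD : (n < (n + D).+1)%N by rewrite ltnS leq_addr.
rewrite (bigD1 (Ordinal nD))//= addKn ler_wpDr//.
  by rewrite sumr_ge0// => i _; rewrite mulrn_wge0// mulr_ge0// exprn_ge0.
by rewrite -[leRHS]mulr_natl -mulrA [p ^+ n * _]mulrC.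
Qed.

Section PowerSeries.
Variable R : realType.
Implicit Types (c : nat -> R) (z : R).

Definition cvg_on_disk c := forall z, `|z| < 1 -> cvgn (pseries c z).

Lemma cvg_pseries_bounded c (M r z : R) :
  (forall n, `|c n| * r ^+ n <= M) -> `|z| < r -> cvgn (pseries c z).
Proof.
move=> cM zr; have r0 : 0 < r by apply: le_lt_trans zr.
have M0 : 0 <= M by apply: le_trans (cM 0%N); rewrite mulr_ge0.
apply: normed_cvg; apply: (@series_le_cvg _ _ (geometric M (`|z| / r))) => [n|n|n|].
- exact: normr_ge0.
- by rewrite /= mulr_ge0// exprn_ge0// divr_ge0// ltW.
- rewrite /= normrM normrX expr_div_n mulrA ler_pdivlMr ?exprn_gt0//.
  by rewrite mulrAC ler_wpM2r// exprn_ge0.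
- apply: is_cvg_geometric_series.
  by rewrite ger0_norm ?divr_ge0 ?(ltW r0)// ltr_pdivrMr// mul1r.
Qed.

Lemma cvg_on_disk_bounded c (r : R) : cvg_on_disk c -> 0 < r < 1 ->
  exists M, forall n, `|c n| * r ^+ n <= M.
Proof.
move=> cc /andP[r0 r1].
have /cvg_series_bounded[M [_ Mc]] : cvgn (pseries c r).
  by apply: cc; rewrite gtr0_norm.
exists (M + 1) => n; rewrite -[r]gtr0_norm// -normrX -normrM.
by apply: Mc => //; rewrite ltrDl.
Qed.

Lemma cvg_on_disk_diffs c : cvg_on_disk c -> cvg_on_disk (pseries_diffs c).
Proof.
(* The radii satisfy [|z| < s < r < 1]: the terms are bounded at [r], passing to [s] absorbs the
   factor [n + 1] of the derivative, and passing to [z] gives convergence. *)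
move=> cc z z1; pose s := (1 + `|z|) / 2; pose r := (1 + s) / 2.
have z0 := normr_ge0 z.
have zs : `|z| < s by rewrite /s; lra.
have sr : s < r by rewrite /r /s; lra.
have r1 : r < 1 by rewrite /r /s; lra.
have s0 : 0 < s by apply: le_lt_trans zs.
have r0 : 0 < r by apply: lt_trans sr.
have [M Mc] := @cvg_on_disk_bounded c r cc ltac:(by rewrite r0 r1).
have p0 : 0 <= s / r <= 1.
  by rewrite divr_ge0 ?(ltW s0) ?(ltW r0)// ler_pdivrMr// mul1r ltW.
have p1 : 0 < 1 - s / r by rewrite subr_gt0 ltr_pdivrMr// mul1r.
apply: (@cvg_pseries_bounded _ (M / r / (1 - s / r)) s) => // n.
rewrite ler_pdivlMr// ler_pdivlMr// /pseries_diffs normrM ger0_norm//.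
have := @binomial_term_le1 R n 1 (s / r) p0.
rewrite addn1 binSn expr1 expr_div_n => bn.
rewrite [leLHS](_ : _ = `|c n.+1| * r ^+ n.+1 *
    (n.+1%:R * (s ^+ n / r ^+ n) * (1 - s / r))); last first.
  by rewrite exprS; field; rewrite ?expf_neq0 ?gt_eqF.
by rewrite -[leRHS]mulr1 ler_pM// ?mulr_ge0 ?exprn_ge0 ?invr_ge0 ?(ltW p1)
  ?(ltW s0) ?(ltW r0) ?exprn_ge0 ?(ltW r0).
Qed.

Lemma is_derive_pseries c z : cvg_on_disk c -> `|z| < 1 ->
  is_derive z 1 (fun x : R => limn (pseries c x)) (limn (pseries (pseries_diffs c) z)).
Proof.
move=> cc z1; pose s := (1 + `|z|) / 2.
have z0 := normr_ge0 z.
have s1 : `|s| < 1 by rewrite /s ger0_norm; lra.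
have zs : `|z| < `|s| by rewrite /s [ltRHS]ger0_norm; lra.
have dc := cvg_on_disk_diffs cc.
apply: (pseries_snd_diffs (cc s s1) (dc s s1) _ zs).
exact: (cvg_on_disk_diffs dc s1).
Qed.

Lemma pseries_at0 c : limn (pseries c 0) = c 0%N.
Proof.
apply: lim_near_cst => //; exists 1%N => // -[//|n] _.
rewrite /pseries /series /= big_nat_recl//= big1 ?addr0 ?mulr1// => i _.
by rewrite expr0n mulr0.
Qed.

Lemma near_unit_disk z : `|z| < 1 -> \forall y \near z, `|y| < 1.
Proof.
move=> z1; have : `|y| @[y --> z] --> `|z| by apply: cvg_norm; exact: cvg_id.
by move=> /cvgr_lt; apply.
Qed.

(** The value at 0 is the constant coefficient. The derived series again sums to 0 on the disk,
    which gives the others by induction. *)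
Lemma pseries_eq0 c : cvg_on_disk c ->
  (forall z, `|z| < 1 -> limn (pseries c z) = 0) -> forall n, c n = 0.
Proof.
move=> cc c0 n; elim: n c cc c0 => [|n IH] c cc c0.
  by rewrite -pseries_at0 c0// normr0.
suff /eqP : pseries_diffs c n = 0 by rewrite mulf_eq0 pnatr_eq0 => /eqP.
apply: IH; first exact: cvg_on_disk_diffs.
move=> z z1; have dz := is_derive_pseries cc z1.
have : is_derive z (1 : R) (fun x : R => limn (pseries c x)) 0.
  have := @is_derive_cst R R R 0 z 1.
  apply: near_eq_is_derive.
  by near do (rewrite c0//); exact: near_unit_disk.
by move=> [_ <-]; case: dz.
Unshelve. all: by end_near. Qed.

Lemma pseries_uniq (c d : nat -> R) (f : R -> R) :
  (forall z, `|z| < 1 -> pseries c z @ \oo --> f z) ->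
  (forall z, `|z| < 1 -> pseries d z @ \oo --> f z) -> forall n, c n = d n.
Proof.
move=> cf df n; apply/eqP; rewrite -subr_eq0; apply/eqP.
have cvg_cd z : `|z| < 1 -> pseries (fun n => c n - d n) z @ \oo --> (0 : R).
  move=> z1; rewrite -(subrr (f z)).
  rewrite (_ : pseries _ _ = pseries c z - pseries d z).
    exact: cvgB (cf z z1) (df z z1).
  apply/funext => m; rewrite /pseries /series /= -[RHS]sumrB.
  by apply: eq_bigr => i _; rewrite mulrBl.
apply: (@pseries_eq0 (fun n => c n - d n)).
- by move=> z /cvg_cd/cvgP.
- by move=> z /cvg_cd/cvg_lim; apply.
Qed.

End PowerSeries.

(** * Identification with the Gegenbauer polynomials *)

Section GegenbauerHat.
Variables (R : realType) (D : nat).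
Hypothesis D_gt0 : (0 < D)%N.

(** The binomial coefficient is the value at 1 of the Gegenbauer polynomial of index [D / 2], so
    these are the unnormalised polynomials. *)
Definition gegen_coef (t : R) n : R := 'C(n + D.-1, n)%:R * gegen D n t.

Local Notation c := gegen_coef.

Lemma gegen_coef0 t : c t 0 = 1. Proof. by rewrite /c bin0 mul1r. Qed.

Lemma gegen_coef1 t : c t 1 = D%:R * t.
Proof. by rewrite /c gegen1 bin1 add1n prednK. Qed.

Lemma gegen_coefSS t n : n.+2%:R * c t n.+2 =
  (2 * n.+1 + D)%:R * t * c t n.+1 - (n + D)%:R * c t n.
Proof.
have binS m : m.+1%:R * 'C(m.+1 + D.-1, m.+1)%:R
    = (m + D)%:R * 'C(m + D.-1, m)%:R :> R.
  by rewrite -!natrM addSn -mul_bin_diag -[in RHS](prednK D_gt0) addnS.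
have gE : (n.+1 + D)%:R * gegen D n.+2 t =
   (2 * n.+1 + D)%:R * t * gegen D n.+1 t - n.+1%:R * gegen D n t.
  rewrite gegenSS [LHS](_ : _ = ((n.+1 + D)%:R + (n.+1 + D)%:R * gegen_mu R D n) * t
    * gegen D n.+1 t - (n.+1 + D)%:R * gegen_mu R D n * gegen D n t); last by ring.
  by rewrite gegen_muE; ring.
rewrite /c mulrA (binS n.+1) mulrAC gE mulrBl.
rewrite [n.+1%:R * _ * _]mulrAC (binS n); ring.
Qed.

Lemma gegen_coef_cvg_on_disk t : t ^+ 2 <= 1 -> cvg_on_disk (c t).
Proof.
move=> t1 z z1; pose r := (1 + `|z|) / 2; have z0 := normr_ge0 z.
have zr : `|z| < r by rewrite /r; lra.
have r1 : 0 < 1 - r by rewrite /r; lra.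
have r0 : 0 <= r by rewrite /r; lra.
apply: (@cvg_pseries_bounded _ _ ((1 - r) ^+ D.-1)^-1 r) => // n.
rewrite -[leRHS]mul1r ler_pdivlMr ?exprn_gt0//.
apply: le_trans (@binomial_term_le1 R n D.-1 r _); last by rewrite r0 -subr_ge0 ltW.
rewrite ler_wpM2r ?exprn_ge0 ?(ltW r1)// ler_wpM2r ?exprn_ge0//.
by rewrite normrM ger0_norm// ler_piMr// gegen_le1.
Qed.

(* The generating function [f] satisfies
   [(1 - 2 t z + z ^ 2) f' = D (t - z) f]; this is the remainder after [N] terms. *)
Lemma gegen_partial_ode t z N :
  (1 - 2 * t * z + z ^+ 2) * pseries (pseries_diffs (c t)) z N
   - D%:R * (t - z) * pseries (c t) z N =
  D%:R * t * (c t N * z ^+ N) - pseries_diffs (c t) N * z ^+ N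
   + z * (N%:R * c t N * z ^+ N).
Proof.
elim: N => [|N IH].
  rewrite /pseries /series /= !big_geq// /pseries_diffs gegen_coef0 gegen_coef1.
  by ring.
have recr d : pseries d z N.+1 = pseries d z N + d N * z ^+ N.
  by rewrite /pseries /series /= big_nat_recr.
rewrite !recr [LHS](_ : _ = ((1 - 2 * t * z + z ^+ 2) *
   pseries (pseries_diffs (c t)) z N - D%:R * (t - z) * pseries (c t) z N) +
   ((1 - 2 * t * z + z ^+ 2) * (pseries_diffs (c t) N * z ^+ N)
     - D%:R * (t - z) * (c t N * z ^+ N))); last by ring.
by rewrite IH /pseries_diffs gegen_coefSS (exprS z N); ring.
Qed.

Lemma gegen_ode (t z : R) : t ^+ 2 <= 1 -> `|z| < 1 ->
  (1 - 2 * t * z + z ^+ 2) * limn (pseries (pseries_diffs (c t)) z) =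
  D%:R * (t - z) * limn (pseries (c t) z).
Proof.
move=> t1 z1; have cc := gegen_coef_cvg_on_disk t1.
have dc := cvg_on_disk_diffs cc.
apply/eqP; rewrite -subr_eq0; apply/eqP.
have L : (fun N => (1 - 2 * t * z + z ^+ 2) * pseries (pseries_diffs (c t)) z N
   - D%:R * (t - z) * pseries (c t) z N) @ \oo -->
   (1 - 2 * t * z + z ^+ 2) * limn (pseries (pseries_diffs (c t)) z) -
  D%:R * (t - z) * limn (pseries (c t) z).
  by apply: cvgB; apply: cvgMl_tmp; [exact: dc|exact: cc].
have L0 : (fun N => (1 - 2 * t * z + z ^+ 2) * pseries (pseries_diffs (c t)) z N
   - D%:R * (t - z) * pseries (c t) z N) @ \oo --> (0 : R).
  rewrite (_ : (fun N => _) = (fun N => D%:R * t * (c t N * z ^+ N)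
     - pseries_diffs (c t) N * z ^+ N + z * (N%:R * c t N * z ^+ N))); last first.
    by apply/funext => N; rewrite gegen_partial_ode.
  have cz : (fun N => c t N * z ^+ N) @ \oo --> (0 : R).
    exact: cvg_series_cvg_0 (cc z z1).
  have dz : (fun N => pseries_diffs (c t) N * z ^+ N) @ \oo --> (0 : R).
    exact: cvg_series_cvg_0 (dc z z1).
  have ez : (fun N => z * (N%:R * c t N * z ^+ N)) @ \oo --> (0 : R).
    rewrite -cvg_shiftS (_ : (fun N => _) =
        fun N => z * z * (pseries_diffs (c t) N * z ^+ N)).
      by have /(_ eventually_filter) := cvgMl_tmp (a := z * z) dz; rewrite mulr0.
    by apply/funext => N /=; rewrite /pseries_diffs (exprS z N); ring.
  have {}cz : (fun N => D%:R * t * (c t N * z ^+ N)) @ \oo --> (0 : R).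
    by have /(_ eventually_filter) := cvgMl_tmp (a := D%:R * t) cz; rewrite mulr0.
  have := cvgD (cvgB cz dz) ez; rewrite subr0 addr0; exact.
exact: cvg_unique L L0.
Qed.

Let w (t z : R) : R := 1 - 2 * t * z + z ^+ 2.

Let w_gt0 (t z : R) : t ^+ 2 <= 1 -> `|z| < 1 -> 0 < w t z.
Proof.
move=> t1 z1; rewrite /w; have : z ^+ 2 < 1 by rewrite -real_normK ?num_real// expr_lt1.
have := sqr_ge0 (t - z); nra.
Qed.

(** By the differential equation the product [g] of the series with the power [D / 2] of [w t] has
    zero derivative on the disk, and its value at 0 is 1. *)
Lemma gegen_generating (t z : R) : t ^+ 2 <= 1 -> `|z| < 1 ->
  limn (pseries (c t) z) = (1 - 2 * t * z + z ^+ 2) `^ (- (D%:R / 2)).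
Proof.
move=> t1 z1; have cc := gegen_coef_cvg_on_disk t1.
pose f (x : R) := limn (pseries (c t) x).
pose g (x : R) : R := f x * w t x `^ (D%:R / 2).
have dg x : `|x| < 1 -> is_derive x (1 : R) g 0.
  move=> x1; have df := is_derive_pseries cc x1.
  have w0 := w_gt0 t1 x1.
  have dw : is_derive x (1 : R) (w t) (2 * x - 2 * t).
    rewrite /w; apply: is_derive_eq; rewrite /GRing.scale /=; ring.
  have dp := is_derive1_powR (D%:R / 2) w0.
  have dpw : is_derive x (1 : R) (fun y => w t y `^ (D%:R / 2))
      (D%:R / 2 * w t x `^ (D%:R / 2 - 1) * (2 * x - 2 * t)).
    exact: is_derive1_comp dp dw.
  apply: (is_derive_eq (is_deriveM df dpw)).
  have ode : w t x * _ = _ := gegen_ode t1 x1.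
  have -> : w t x `^ (D%:R / 2) = w t x * w t x `^ (D%:R / 2 - 1).
    by rewrite mulr_powRB1 ?(ltW w0)// divr_gt0// ltr0n.
  set P := _ `^ (_ - 1); rewrite /GRing.scale /=.
  move: ode; set f' := limn _; rewrite -/(f x) => ode.
  rewrite [LHS](_ : _ = f x * (D%:R / 2 * P * (2 * x - 2 * t)) + P * (w t x * f')).
    by rewrite ode; field.
  by ring.
have gz : g z = g 0.
  have [z0|z0|->//] := ltgtP z 0.
  - have [||x _] := @MVT _ g (fun _ => 0) z 0 z0.
    + move=> x; rewrite in_itv/= => /andP[zx x0]; apply: dg.
      by rewrite ltr0_norm//; rewrite ltr0_norm// in z1; lra.
    + apply: derivable_within_continuous => x; rewrite in_itv/= => /andP[zx x0].
      have x1 : `|x| < 1 by rewrite ler0_norm//; rewrite ltr0_norm// in z1; lra.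
      by have [] := dg x x1.
    by rewrite mul0r => /eqP; rewrite subr_eq0 => /eqP.
  - have [||x _] := @MVT _ g (fun _ => 0) 0 z z0.
    + move=> x; rewrite in_itv/= => /andP[x0 xz]; apply: dg.
      by rewrite gtr0_norm//; rewrite gtr0_norm// in z1; lra.
    + apply: derivable_within_continuous => x; rewrite in_itv/= => /andP[x0 xz].
      have x1 : `|x| < 1 by rewrite ger0_norm//; rewrite gtr0_norm// in z1; lra.
      by have [] := dg x x1.
    by rewrite mul0r => /eqP; rewrite subr_eq0 => /eqP.
have g0 : g 0 = 1.
  by rewrite /g /f /w pseries_at0 gegen_coef0 mulr0 subr0 expr0n addr0 powR1 mulr1.
have wn0 : w t z `^ (D%:R / 2) != 0 by rewrite gt_eqF// powR_gt0// w_gt0.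
rewrite powRN -/(w t z) -/(f z) -[RHS]mul1r; apply: (canRL (mulfK wn0)).
exact: etrans gz g0.
Qed.

(** [gegenbauer] chooses some sequence with the prescribed generating function; [gegen_generating]
    provides one and [pseries_uniq] shows that there is no other. *)
Lemma gegenbauerE (t : R) : t ^+ 2 <= 1 -> gegenbauer (D%:R / 2) ^~ t = c t.
Proof.
move=> t1; apply/funext => n; rewrite /gegenbauer.
set S := [set C : nat -> R | _].
have Sc : S (c t).
  by move=> z z1; rewrite -gegen_generating//; exact: gegen_coef_cvg_on_disk.
have SC : S (get S) := getI Sc.
exact: (pseries_uniq SC Sc).
Qed.

Lemma gegenbauer_hatE n (t : R) : t ^+ 2 <= 1 ->
  gegenbauer_hat (D%:R / 2)%:E n t = gegen D n t.
Proof.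
move=> t1; rewrite /gegenbauer_hat.
have := congr1 (@^~ n) (gegenbauerE t1) => /= ->.
have /(congr1 (@^~ n))/= -> := @gegenbauerE 1 ltac:(by rewrite expr1n).
rewrite /c gegen_at1 mulr1 mulrAC divff ?mul1r//.
by rewrite pnatr_eq0 -lt0n bin_gt0 leq_addr.
Qed.

End GegenbauerHat.

(** * Positive semidefinite matrices *)

Section ComplexSequences.
Variable R : realType.
Implicit Types (u : nat -> R[i]) (l : R[i]).

Lemma ReD (x y : R[i]) : complex.Re (x + y) = complex.Re x + complex.Re y.
Proof. by case: x y => [? ?] []. Qed.

Lemma ImD (x y : R[i]) : complex.Im (x + y) = complex.Im x + complex.Im y.
Proof. by case: x y => [? ?] []. Qed.

Lemma ReB (x y : R[i]) : complex.Re (x - y) = complex.Re x - complex.Re y.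
Proof. by case: x y => [? ?] []. Qed.

Lemma ImB (x y : R[i]) : complex.Im (x - y) = complex.Im x - complex.Im y.
Proof. by case: x y => [? ?] []. Qed.

Lemma ReN (x : R[i]) : complex.Re (- x) = - complex.Re x.
Proof. by case: x. Qed.

Lemma Re_sum (I : Type) (r : seq I) (P : pred I) (F : I -> R[i]) :
  complex.Re (\sum_(i <- r | P i) F i) = \sum_(i <- r | P i) complex.Re (F i).
Proof. by apply: (big_morph (@complex.Re R)) => //; exact: ReD. Qed.

Lemma Im_sum (I : Type) (r : seq I) (P : pred I) (F : I -> R[i]) :
  complex.Im (\sum_(i <- r | P i) F i) = \sum_(i <- r | P i) complex.Im (F i).
Proof. by apply: (big_morph (@complex.Im R)) => //; exact: ImD. Qed.

Lemma ReMr (x : R[i]) (a : R) : complex.Re (x * a%:C%C) = complex.Re x * a.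
Proof. by case: x => x y /=; rewrite mulr0 subr0. Qed.

Lemma ImMr (x : R[i]) (a : R) : complex.Im (x * a%:C%C) = complex.Im x * a.
Proof. by case: x => x y /=; rewrite mulr0 add0r. Qed.

Lemma complex_ge0E (x : R[i]) :
  (0 <= x) = (complex.Im x == 0) && (0 <= complex.Re x).
Proof. by rewrite lecE. Qed.

Lemma complex_gt0E (x : R[i]) :
  (0 < x) = (complex.Im x == 0) && (0 < complex.Re x).
Proof. by rewrite ltcE. Qed.

Lemma normr_Re_le (x : R[i]) : (`|complex.Re x|)%:C%C <= `|x|.
Proof.
rewrite normc_def lecR -sqrtr_sqr ler_sqrt ?addr_ge0 ?sqr_ge0//.
by rewrite lerDl sqr_ge0.
Qed.

Lemma normr_Im_le (x : R[i]) : (`|complex.Im x|)%:C%C <= `|x|.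
Proof.
rewrite normc_def lecR -sqrtr_sqr ler_sqrt ?addr_ge0 ?sqr_ge0//.
by rewrite lerDr sqr_ge0.
Qed.

Lemma cvg_Re u l : u @ \oo --> l ->
  (fun n => complex.Re (u n)) @ \oo --> complex.Re l.
Proof.
move=> /cvgrPdist_lt ul; apply/cvgrPdist_lt => e e0.
have := ul e%:C%C; rewrite ltcR => /(_ e0); apply: filterS => n.
rewrite -ReB -ltcR; apply: le_lt_trans; exact: normr_Re_le.
Qed.

Lemma cvg_Im u l : u @ \oo --> l ->
  (fun n => complex.Im (u n)) @ \oo --> complex.Im l.
Proof.
move=> /cvgrPdist_lt ul; apply/cvgrPdist_lt => e e0.
have := ul e%:C%C; rewrite ltcR => /(_ e0); apply: filterS => n.
rewrite -ImB -ltcR; apply: le_lt_trans; exact: normr_Im_le.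
Qed.

Lemma cvg_complex_lim u l : u @ \oo --> l -> limn u = l.
Proof. by apply: cvg_lim; exact: norm_hausdorff. Qed.

Lemma cvg_ge0 u l : (forall n, 0 <= u n) -> u @ \oo --> l -> 0 <= l.
Proof.
move=> u0 ul; rewrite complex_ge0E; apply/andP; split.
  have Iul := cvg_Im ul; rewrite -(cvg_lim (@Rhausdorff R) Iul).
  rewrite (_ : (fun n => _) = cst 0) ?lim_cst//.
  by apply/funext => n; have := u0 n; rewrite complex_ge0E => /andP[/eqP].
have Rul := cvg_Re ul; rewrite -(cvg_lim (@Rhausdorff R) Rul)//; apply: limr_ge.
  exact: cvgP Rul.
by near=> n; have := u0 n; rewrite complex_ge0E => /andP[].
Unshelve. all: by end_near. Qed.

Lemma cvg_series_gt0 u l k : (forall n, 0 <= u n) -> series u @ \oo --> l ->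
  0 < u k -> 0 < l.
Proof.
move=> u0 ul uk; rewrite -subr_gt0 subr0; apply: (lt_le_trans uk).
(* Shifting the index by [k.+1] puts the term [u k] into every partial sum. *)
rewrite -subr_ge0; apply: (@cvg_ge0 (fun n => series u (n + k.+1)%N - u k)).
  move=> n; rewrite subr_ge0 addnS /series /= big_mkord.
  have kn : (k < (n + k).+1)%N by rewrite ltnS leq_addl.
  by rewrite (bigD1 (Ordinal kn))//= lerDl sumr_ge0.
by apply: cvgB; [rewrite (cvg_shiftn k.+1)|exact: cvg_cst].
Qed.

Lemma cvg_series0 u l : (forall n, u n = 0) -> series u @ \oo --> l -> l = 0.
Proof.
move=> u0 /cvg_complex_lim <-; rewrite (_ : series u = cst 0) ?lim_cst//.
by apply/funext => n; rewrite /series /= big1.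
Qed.

Lemma cvg_sum_complex (I : Type) (r : seq I) (F : I -> nat -> R[i]) (L : I -> R[i]) :
  (forall i, F i @ \oo --> L i) ->
  (fun n => \sum_(i <- r) F i n) @ \oo --> \sum_(i <- r) L i.
Proof.
by move=> FL; apply: cvg_big => [|i _]; [exact: add_continuous|exact: FL].
Qed.

End ComplexSequences.

Section PositiveMatrices.
Variables (R : realType) (m : nat).
Implicit Types (A : 'I_m -> 'I_m -> R[i]) (c : 'I_m -> R[i]).

Definition hform A c d : R[i] := \sum_(i < m) \sum_(j < m) c i * (d j)^* * A i j.

Definition psd A := forall c, 0 <= hform A c c.

Lemma conj_real_complex (a : R) : (a%:C%C)^* = a%:C%C.
Proof. by apply/CrealP; apply/complex_realP; exists a. Qed.

(** A factor of the form [phi i * phi j] only rescales the coefficients, and a Gram kernel is a sum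
    of such factors; this is the Schur product theorem. *)
Lemma psd_gram (I : finType) (phi : I -> 'I_m -> R) A : psd A ->
  psd (fun i j => A i j * (\sum_a phi a i * phi a j)%:C%C).
Proof.
move=> Apsd c; rewrite /hform.
rewrite [X in 0 <= X](_ : _ =
  \sum_a hform A (fun i => c i * (phi a i)%:C%C) (fun i => c i * (phi a i)%:C%C)).
  by rewrite sumr_ge0.
rewrite /hform exchange_big /=; under [RHS]eq_bigr do rewrite exchange_big /=.
rewrite [RHS]exchange_big /=; apply: eq_bigr => j _.
rewrite [RHS]exchange_big /=; apply: eq_bigr => i _.
rewrite rmorph_sum !mulr_sumr; apply: eq_bigr => a _ /=.
by rewrite !rmorphM /= conj_real_complex; ring.
Qed.

Lemma psd_cvg (A : 'I_m -> 'I_m -> R[i]) (F : nat -> 'I_m -> 'I_m -> R)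
    (f : 'I_m -> 'I_m -> R) :
  (forall n, psd (fun i j => A i j * (F n i j)%:C%C)) ->
  (forall i j, (fun n => F n i j) @ \oo --> f i j) ->
  psd (fun i j => A i j * (f i j)%:C%C).
Proof.
move=> Fpsd Ff c; rewrite complex_ge0E /hform.
pose B i j := c i * (c j)^* * A i j.
have ReB (g : 'I_m -> 'I_m -> R) : complex.Re (\sum_i \sum_j c i * (c j)^* *
    (A i j * (g i j)%:C%C)) = \sum_i \sum_j complex.Re (B i j) * g i j.
  rewrite Re_sum; apply: eq_bigr => i _; rewrite Re_sum; apply: eq_bigr => j _.
  by rewrite mulrA ReMr.
have ImB (g : 'I_m -> 'I_m -> R) : complex.Im (\sum_i \sum_j c i * (c j)^* *
    (A i j * (g i j)%:C%C)) = \sum_i \sum_j complex.Im (B i j) * g i j.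
  rewrite Im_sum; apply: eq_bigr => i _; rewrite Im_sum; apply: eq_bigr => j _.
  by rewrite mulrA ImMr.
have cvgF (b : 'I_m -> 'I_m -> R) :
    (fun n => \sum_i \sum_j b i j * F n i j) @ \oo --> \sum_i \sum_j b i j * f i j.
  apply: cvg_big => [|i _]; first exact: add_continuous.
  apply: cvg_big => [|j _]; first exact: add_continuous.
  by apply: cvgMl_tmp; exact: Ff.
rewrite ReB ImB; apply/andP; split.
  rewrite -(cvg_lim (@Rhausdorff R) (cvgF _))// (_ : (fun n => _) = cst 0) ?lim_cst//.
  apply/funext => n; rewrite -ImB.
  by have := Fpsd n c; rewrite complex_ge0E => /andP[/eqP].
rewrite -(cvg_lim (@Rhausdorff R) (cvgF (fun i j => complex.Re (B i j))))//.
apply: limr_ge; first exact: cvgP (cvgF _).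
by near=> n; rewrite -ReB; have := Fpsd n c; rewrite complex_ge0E => /andP[].
Unshelve. all: by end_near. Qed.

End PositiveMatrices.

(** * Unit vectors in an inner product space *)

Section InnerProduct.
Variables (R : realType) (V : innerProdType R).
Implicit Types x y z : V.

Lemma dotDr x y z : dot x (y + z) = dot x y + dot x z.
Proof. by rewrite dotC dotDl !(dotC x). Qed.

Lemma dotZr (a : R) x y : dot x (a *: y) = a * dot x y.
Proof. by rewrite dotC dotZl dotC. Qed.

Lemma dotNl x y : dot (- x) y = - dot x y.
Proof. by rewrite -scaleN1r dotZl mulN1r. Qed.

Lemma dotNr x y : dot x (- y) = - dot x y.
Proof. by rewrite dotC dotNl dotC. Qed.

Lemma dot_unit_norm x : `|x| = 1 -> dot x x = 1.
Proof. by move=> x1; rewrite dotxx x1 expr1n. Qed.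

Lemma dot_unit_eq x y : `|x| = 1 -> `|y| = 1 -> dot x y = 1 -> x = y.
Proof.
move=> /dot_unit_norm x1 /dot_unit_norm y1 xy; apply/eqP.
rewrite -subr_eq0 -normr_eq0 -sqrf_eq0 -dotxx dotDl !dotDr !(dotNl, dotNr).
by rewrite (dotC y x) x1 y1 xy; apply/eqP; ring.
Qed.

Lemma dot_unit_eqN x y : `|x| = 1 -> `|y| = 1 -> dot x y = -1 -> x = - y.
Proof.
by move=> x1 y1 xy; apply: dot_unit_eq; rewrite ?normrN// dotNr xy opprK.
Qed.

Lemma dot_unit_sqr_le1 x y : `|x| = 1 -> `|y| = 1 -> dot x y ^+ 2 <= 1.
Proof.
move=> /dot_unit_norm x1 /dot_unit_norm y1.
have := sqr_ge0 (`|x - dot x y *: y|); rewrite -dotxx.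
rewrite dotDl !dotDr !(dotNl, dotNr) !dotZl !dotZr (dotC y x) x1 y1; lra.
Qed.

Lemma norm_normalize x : x != 0 -> `| `|x|^-1 *: x| = 1.
Proof.
by move=> x0; rewrite normrZ normfV normr_id mulVf// normr_eq0.
Qed.

End InnerProduct.

(** * Finite rank kernels and weights annihilating them *)

Definition finite_rank (R : realType) (X : Type) (G : X -> X -> R) : Prop :=
  exists (I : finType) (phi psi : I -> X -> R),
    forall x y, G x y = \sum_a phi a x * psi a y.

Section FiniteRank.
Variables (R : realType) (X : Type).
Implicit Types G H : X -> X -> R.

Lemma finite_rank_prod (f g : X -> R) : finite_rank (fun x y => f x * g y).
Proof.
by exists unit, (fun=> f), (fun=> g) => x y; rewrite (big_pred1 tt)// => -[].
Qed.

Lemma finite_rankD G H : finite_rank G -> finite_rank H ->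
  finite_rank (fun x y => G x y + H x y).
Proof.
move=> [I [f [g Gfg]]] [J [h [k Hhk]]].
exists (I + J)%type, (fun a => match a with inl i => f i | inr j => h j end),
  (fun a => match a with inl i => g i | inr j => k j end) => x y.
by rewrite big_sumType /= Gfg Hhk.
Qed.

Lemma finite_rankM G H : finite_rank G -> finite_rank H ->
  finite_rank (fun x y => G x y * H x y).
Proof.
move=> [I [f [g Gfg]]] [J [h [k Hhk]]].
exists (I * J)%type, (fun a x => f a.1 x * h a.2 x), (fun a x => g a.1 x * k a.2 x).
move=> x y; rewrite Gfg Hhk mulr_suml.
rewrite -(pair_bigA _ (fun i j => f i x * h j x * (g i y * k j y))) /=.
apply: eq_bigr => i _; rewrite mulr_sumr; apply: eq_bigr => j _; ring.
Qed.

Lemma finite_rank_cst (a : R) : finite_rank (fun _ _ : X => a).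
Proof.
have [I [f [g fg]]] := finite_rank_prod (fun=> a) (fun=> 1).
by exists I, f, g => x y; rewrite -fg mulr1.
Qed.

Lemma finite_rank_three_term (mu : nat -> R) G n : finite_rank G ->
  finite_rank (fun x y => three_term mu (G x y) 1 n).
Proof.
move=> fG; elim/nat_ind2: n => [||n IH0 IH1] //; first exact: finite_rank_cst.
have fS := finite_rankM (finite_rankM (finite_rank_cst (1 + mu n)) fG) IH1.
have [I [f [g fg]]] := finite_rankD fS (finite_rankM (finite_rank_cst (- mu n)) IH0).
by exists I, f, g => x y; rewrite -fg three_termSS; ring.
Qed.

End FiniteRank.

Section Annihilator.
Variable R : realType.

Lemma finite_rank_features (G : nat -> nat -> nat -> R) N :
  (forall n, finite_rank (G n)) -> exists (I : finType) (phi : I -> nat -> R),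
    forall (M : nat) (w : 'I_M -> R),
      (forall a, \sum_k w k * phi a k = 0) ->
      forall n, (n < N)%N -> \sum_k \sum_l w k * w l * G n k l = 0.
Proof.
move=> fG; elim: N => [|N [I [phi IH]]]; first by exists void, (fun=> fun=> 0).
have [J [f [g fg]]] := fG N.
exists (I + J)%type, (fun a => match a with inl i => phi i | inr j => f j end).
move=> M w w0 n; rewrite ltnS leq_eqVlt => /predU1P[->|nN]; last first.
  by apply: IH => // a; exact: (w0 (inl a)).
rewrite exchange_big big1// => l _.
under eq_bigr do rewrite fg mulr_sumr.
rewrite exchange_big big1//= => a _.
rewrite (eq_bigr (fun k => w k * f a k * (w l * g a l))) => [|k _]; last by ring.
by rewrite -mulr_suml (w0 (inr a)) mul0r.
Qed.

Lemma exists_annihilator (G : nat -> nat -> nat -> R) N :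
  (forall n, finite_rank (G n)) -> exists (M : nat) (w : 'I_M -> R),
    (exists k, w k != 0) /\
    forall n, (n < N)%N -> \sum_k \sum_l w k * w l * G n k l = 0.
Proof.
move=> fG; have [I [phi phiP]] := finite_rank_features N fG.
(* One more point than features, so that the matrix has a nonzero left kernel. *)
pose A : 'M[R]_(#|I|.+1, #|I|) := \matrix_(k, a) phi (enum_val a) k.
have : kermx A != 0.
  rewrite -mxrank_eq0 mxrank_ker subn_eq0 -ltnNge ltnS.
  exact: rank_leq_col.
move=> /rowV0Pn[v /sub_kermxP vA v0].
exists #|I|.+1, (fun k => v 0 k); split.
  have [k vk|v00] := pickP (fun k => v 0 k != 0); first by exists k.
  by case/eqP: v0; apply/rowP => k; rewrite mxE; apply/eqP; rewrite -[_ == _]negbK v00.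
apply: phiP => a; have /matrixP/(_ 0 (enum_rank a)) := vA.
rewrite !mxE => vA0; rewrite -[RHS]vA0; apply: eq_bigr => k _.
by rewrite mxE enum_rankK.
Qed.

End Annihilator.

(** * The space of square summable sequences *)

Section Ell2.
Variable R : realType.

Lemma ell2_cvg_dot (x y : ell2 R) : series (fun n => x n * y n) @ \oo --> dot x y.
Proof.
suff : cvgn (series (fun n => x n * y n)) by [].
have sq (z : ell2 R) : cvgn (series (fun n => z n ^+ 2)).
  exact/square_summableP/ell2P.
(* Polarisation reduces the series of products to series of squares, which converge by membership in
   [ell2]. *)
rewrite (_ : (fun n => _) = 2^-1 *: ((fun n => (x + y) n ^+ 2)
   - ((fun n => x n ^+ 2) + (fun n => y n ^+ 2)))); last first.
  apply/funext => n.
  change (x n * y n = 2^-1 * ((x n + y n) ^+ 2 - (x n ^+ 2 + y n ^+ 2))).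
  by field.
apply: is_cvg_seriesZ; apply: is_cvg_seriesB; first exact: sq.
by apply: is_cvg_seriesD; exact: sq.
Qed.

Let unit_seq (i n : nat) : R := (n == i)%:R.

Let series_unit_seq (i j : nat) :
  \forall n \near \oo, series (fun n => unit_seq i n * unit_seq j n) n = (i == j)%:R.
Proof.
near=> n; have ni : (i < n)%N by near: n; exact: nbhs_infty_gt.
rewrite /series /= big_mkord (bigD1 (Ordinal ni))//= big1 => [|k ki].
  by rewrite /unit_seq eqxx mul1r addr0.
rewrite /unit_seq; case: eqP => [ik|_]; last by rewrite mul0r.
by case/eqP: ki; apply: val_inj.
Unshelve. all: by end_near. Qed.

Let unit_seqP i : unit_seq i \in @square_summable R.
Proof.
apply/square_summableP; apply/cvg_ex; exists (1 : R); apply: cvg_near_cst.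
by apply: filterS (series_unit_seq i i) => n; rewrite eqxx.
Qed.

Lemma ell2_orthonormal : exists e1 e2 : ell2 R,
  [/\ dot e1 e1 = 1, dot e2 e2 = 1 & dot e1 e2 = 0].
Proof.
have dotE i j : dot (Ell2 (unit_seqP i)) (Ell2 (unit_seqP j)) = (i == j)%:R.
  rewrite -(cvg_lim (@Rhausdorff R) 
    (@ell2_cvg_dot (Ell2 (unit_seqP i)) (Ell2 (unit_seqP j)))).
  by apply: lim_near_cst; [exact: Rhausdorff|exact: series_unit_seq].
by exists (Ell2 (unit_seqP 0)), (Ell2 (unit_seqP 1)); rewrite !dotE.
Qed.

Lemma ell2_psd_dot m (x : 'I_m -> ell2 R) (A : 'I_m -> 'I_m -> R[i]) :
  psd A -> psd (fun i j => A i j * (dot (x i) (x j))%:C%C).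
Proof.
move=> Apsd; apply: (@psd_cvg _ _ _ (fun N i j => series (fun n => x i n * x j n) N)).
  move=> n; have := @psd_gram _ _ _ (fun (a : 'I_n) i => x i a) _ Apsd.
  congr psd; apply/funext => i; apply/funext => j.
  by rewrite /series /= big_mkord.
by move=> i j; exact: ell2_cvg_dot.
Qed.

End Ell2.

(** * Finite and infinite dimension treated together *)

Section Dimension.
Variable R : realType.
Implicit Type d : dimension.

(** With coefficients 0 the recurrence produces [t ^+ n], so the infinite dimension fits the same
    scheme as the finite ones. *)
Definition zonal_mu d (n : nat) : R :=
  if d is Findim k then gegen_mu R (k - 2) n else 0.

Definition zonal_hat d n (t : R) : R := three_term (zonal_mu d) t 1 n.

Lemma gegenbauer_hat_lambda d n (t : R) : dim_ge3 d -> t ^+ 2 <= 1 ->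
  gegenbauer_hat (lambda d) n t = zonal_hat d n t.
Proof.
case: d => [k|] d3 t1; last by rewrite /= /zonal_hat three_term_mu0.
have k2 : (2 < k)%N := d3.
rewrite /lambda (_ : (k%:R - 2) / 2 = (k - 2)%:R / 2); last by rewrite natrB// ltnW.
by rewrite gegenbauer_hatE// subn_gt0.
Qed.

Lemma zonal_hat_at1 d n : zonal_hat d n 1 = 1.
Proof. exact: three_term_at1. Qed.

Lemma zonal_hatN d n t : zonal_hat d n (- t) = (-1) ^+ n * zonal_hat d n t.
Proof. exact: three_termN. Qed.

Lemma zonal_hat_cvg0 d t e : dim_ge3 d -> t ^+ 2 < 1 -> 0 < e ->
  exists N, forall n, (N <= n)%N -> `|zonal_hat d n t| <= e.
Proof.
case: d => [k|] /= d3 t1 e0.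
  by apply: (@gegen_cvg0 R (k - 2)); rewrite ?subn_gt0.
have t1' : `|t| < 1 by rewrite -(@expr_lt1 _ 2)// real_normK ?num_real.
have /cvgrPdist_le/(_ e e0)[N _ NP] := cvg_expr t1'.
exists N => n /NP; rewrite sub0r normrN; apply: le_trans.
by rewrite /zonal_hat three_term_mu0.
Qed.

Lemma Rd_orthonormal d : dim_ge3 d -> exists e1 e2 : Rd R d,
  [/\ dot e1 e1 = 1, dot e2 e2 = 1 & dot e1 e2 = 0].
Proof.
case: d => [k|] /= d3; last exact: ell2_orthonormal.
have k1 : (1 < k)%N by apply: ltn_trans d3.
pose i1 := Ordinal (ltnW k1); pose i2 := Ordinal k1.
have dotE (i j : 'I_k) : dot (delta_mx 0 i : euclid R k) (delta_mx 0 j) = (i == j)%:R.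
  rewrite [LHS](bigD1 i)//= !mxE !eqxx /= mul1r big1 ?addr0// => l li.
  by rewrite !mxE (negbTE li) mul0r.
by exists (delta_mx 0 i1), (delta_mx 0 i2); rewrite !dotE.
Qed.

(** In finite dimension the addition theorem writes the zonal factor as a Gram kernel. In infinite
    dimension it is the [n]-th power of the inner product, reached by [n] Schur products. *)
Lemma psd_zonal_hat d n m (x : 'I_m -> Rd R d) (A : 'I_m -> 'I_m -> R[i]) :
  dim_ge3 d -> (forall i, `|x i| = 1) -> psd A ->
  psd (fun i j => A i j * (zonal_hat d n (dot (x i) (x j)))%:C%C).
Proof.
case: d x => [k|] x /= d3 x1 Apsd.
  case: k d3 x x1 => [//|[//|k]] _ x x1.
  have v1 i : \sum_l (x i : 'rV_ _) 0 l * (x i : 'rV_ _) 0 l = 1.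
    exact: (dot_unit_norm (x1 i)).
  have [I [phi gE]] := gegen_gram n v1.
  have := psd_gram phi Apsd; congr psd; apply/funext => i; apply/funext => j.
  by rewrite -gE /zonal_hat /zonal_mu subSS subSS subn0.
have powpsd : psd (fun i j => A i j * (dot (x i) (x j) ^+ n)%:C%C).
  elim: n => [|n IH].
    move: Apsd; congr psd; apply/funext => i; apply/funext => j.
    by rewrite expr0 mulr1.
  have := ell2_psd_dot x IH; congr psd; apply/funext => i; apply/funext => j.
  by rewrite exprSr rmorphM mulrA.
move: powpsd; congr psd; apply/funext => i; apply/funext => j.
by rewrite /zonal_hat three_term_mu0.
Qed.

End Dimension.

(** * Points grouped by lines through the origin *)

(** Each off-diagonal term of the symmetrised sum is at least [- e * (b k k + b l l)], and summation
    over the other index gives the factor [m]. The alternative [b k l + b l k = 0] serves pairs in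
    which some index does not represent its line. *)
Lemma diag_dominance (R : realType) (m : nat) (g b : 'I_m -> 'I_m -> R) (e : R) :
  0 <= e -> (forall k l, g k l = g l k) -> (forall k, g k k = 1) ->
  (forall k l, `|b k l + b l k| <= b k k + b l l) ->
  (forall k l, k != l -> `|g k l| <= e \/ b k l + b l k = 0) ->
  (1 - e * m%:R) * \sum_k b k k <= \sum_k \sum_l g k l * b k l.
Proof.
move=> e0 gC g1 bP ge.
have bkk k : 0 <= b k k by have := bP k k; have := normr_ge0 (b k k + b k k); lra.
rewrite -(@ler_pM2l _ 2)//.
have -> : 2 * (\sum_k \sum_l g k l * b k l) =
    \sum_k \sum_l g k l * (b k l + b l k).
  rewrite mulr_natl mulr2n {2}exchange_big -big_split; apply: eq_bigr => k _ /=.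
  by rewrite -big_split; apply: eq_bigr => l _ /=; rewrite (gC l k) mulrDr.
have -> : 2 * ((1 - e * m%:R) * \sum_k b k k) =
    \sum_k \sum_l ((k == l)%:R * (2 * b k k) - e * (b k k + b l l)).
  pose S := \sum_k b k k.
  rewrite [RHS](eq_bigr (fun k => 2 * b k k - (e * m%:R * b k k + e * S))) => [|k _].
    rewrite sumrB big_split /= -!mulr_sumr sumr_const card_ord -/S -[S *+ _]mulr_natr.
    ring.
  rewrite sumrB (bigD1 k)//= eqxx mul1r big1 ?addr0 => [|l]; last first.
    by rewrite eq_sym => /negbTE ->; rewrite mul0r.
  congr (_ - _); rewrite -mulr_sumr big_split /= sumr_const card_ord -/S.
  by rewrite -mulr_natr; ring.
apply: ler_sum => k _; apply: ler_sum => l _.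
have [->|kl] := eqVneq k l.
  by rewrite g1 ?eqxx !mul1r; have := bkk l; have := mulr_ge0 e0 (bkk l); lra.
rewrite mul0r sub0r.
have [gkl|->] := ge k l kl; last first.
  by rewrite mulr0 oppr_le0 mulr_ge0// addr_ge0.
rewrite lerNl; apply: (le_trans (ler_norm _)); rewrite normrN normrM.
by apply: ler_pM.
Qed.

Section HermitianForms.
Variables (R : realType) (m : nat) (A : 'I_m -> 'I_m -> R[i]).
Implicit Types c d : 'I_m -> R[i].

Lemma hformDl c c' d : hform A (fun i => c i + c' i) d = hform A c d + hform A c' d.
Proof.
rewrite -big_split; apply: eq_bigr => i _; rewrite -big_split /=.
by apply: eq_bigr => j _; rewrite -!mulrDl.
Qed.

Lemma hformDr c d d' : hform A c (fun i => d i + d' i) = hform A c d + hform A c d'.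
Proof.
rewrite -big_split; apply: eq_bigr => i _; rewrite -big_split /=.
by apply: eq_bigr => j _; rewrite rmorphD mulrDr mulrDl.
Qed.

Lemma hformNl c d : hform A (fun i => - c i) d = - hform A c d.
Proof.
rewrite -sumrN; apply: eq_bigr => i _; rewrite -sumrN.
by apply: eq_bigr => j _; rewrite !mulNr.
Qed.

Lemma hformNr c d : hform A c (fun i => - d i) = - hform A c d.
Proof.
rewrite -sumrN; apply: eq_bigr => i _; rewrite -sumrN.
by apply: eq_bigr => j _; rewrite rmorphN mulrN mulNr.
Qed.

Lemma hform0l c d : (forall i, c i = 0) -> hform A c d = 0.
Proof.
by move=> c0; rewrite /hform big1// => i _; rewrite big1// => j _;
  rewrite c0 !mul0r.
Qed.

Lemma hform0r c d : (forall i, d i = 0) -> hform A c d = 0.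
Proof.
by move=> d0; rewrite /hform big1// => i _; rewrite big1// => j _;
  rewrite d0 rmorph0 mulr0 mul0r.
Qed.

(** Expand the nonnegative forms of [c + d] and [c - d]. *)
Lemma psd_cross_le c d : psd A ->
  `|complex.Re (hform A c d) + complex.Re (hform A d c)| <=
  complex.Re (hform A c c) + complex.Re (hform A d d).
Proof.
move=> Apsd; have := Apsd (fun i => c i + d i); have := Apsd (fun i => c i - d i).
rewrite !hformDl !hformDr hformNl !hformNr hformNl !complex_ge0E.
move=> /andP[_ m0] /andP[_ p0]; move: m0 p0; rewrite !ReD !ReN => m0 p0.
by rewrite ler_norml; apply/andP; split; lra.
Qed.

End HermitianForms.

Section Lines.
Variables (R : realType) (V : innerProdType R) (m : nat) (xi : 'I_m -> V).
Hypothesis xi1 : forall i, `|xi i| = 1.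

(* Two indices have the same representative exactly when the corresponding unit
   vectors are equal or opposite. *)
Definition line_rep i : 'I_m := odflt i [pick j | dot (xi i) (xi j) ^+ 2 == 1].

Definition line_sign i : R := dot (xi i) (xi (line_rep i)).

Lemma line_sign_sqr i : line_sign i ^+ 2 = 1.
Proof.
rewrite /line_sign /line_rep; case: pickP => /= [j /eqP//|/(_ i)].
by rewrite dot_unit_norm// expr1n eqxx.
Qed.

Lemma collinearP i j : dot (xi i) (xi j) ^+ 2 = 1 ->
  xi i = dot (xi i) (xi j) *: xi j.
Proof.
move=> /eqP; rewrite sqrf_eq1 => /orP[/eqP ij|/eqP ij]; rewrite ij.
  by rewrite scale1r; apply: dot_unit_eq.
by rewrite scaleN1r; apply: dot_unit_eqN.
Qed.

Lemma line_signE i : xi i = line_sign i *: xi (line_rep i).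
Proof. exact/collinearP/line_sign_sqr. Qed.

Lemma line_rep_eq i j : dot (xi i) (xi j) ^+ 2 = 1 -> line_rep i = line_rep j.
Proof.
move=> ij; rewrite /line_rep.
rewrite (eq_pick (Q := fun l => dot (xi j) (xi l) ^+ 2 == 1)); last first.
  by move=> l; rewrite (collinearP ij) dotZl exprMn ij mul1r.
by case: pickP => [//|/(_ j)]; rewrite dot_unit_norm// expr1n eqxx.
Qed.

Lemma line_rep_rep i : line_rep (line_rep i) = line_rep i.
Proof. by apply/esym/line_rep_eq/line_sign_sqr. Qed.

Lemma line_sign_exp i n : line_sign i ^+ n = line_sign i ^+ odd n.
Proof.
rewrite -{1}(odd_double_half n) exprD -mul2n exprM line_sign_sqr expr1n mulr1.
by [].
Qed.

(** Replacing a unit vector by the representative of its line costs its sign, raised to the degree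
    [p] because the zonal polynomial has the parity of its degree. The last factor keeps only the
    indices of line [k]. *)
Definition line_coef (c : 'I_m -> R[i]) (p : nat) (k i : 'I_m) : R[i] :=
  c i * (line_sign i ^+ p)%:C%C * (line_rep i == k)%:R.

End Lines.

Lemma sum_delta (R : pzRingType) (I : finType) (F : I -> R) (k : I) :
  \sum_l F l * (k == l)%:R = F k.
Proof.
rewrite (bigD1 k)//= eqxx mulr1 big1 ?addr0// => l.
by rewrite eq_sym => /negbTE ->; rewrite mulr0.
Qed.

Section LineBlocks.
Variables (R : realType) (d : dimension) (m : nat) (xi : 'I_m -> Rd R d).
Hypothesis d_ge3 : dim_ge3 d.
Hypothesis xi1 : forall i, `|xi i| = 1.
Local Notation g := (@zonal_hat R d).

Lemma zonal_hat_sign (s t : R) n : s ^+ 2 = 1 -> g n (s * t) = s ^+ n * g n t.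
Proof.
move=> /eqP; rewrite sqrf_eq1 => /orP[/eqP->|/eqP->].
  by rewrite mul1r expr1n mul1r.
by rewrite mulN1r zonal_hatN.
Qed.

(** Between the points of two fixed lines the zonal factor is constant up to signs, so the form
    splits into blocks indexed by pairs of representatives; the blocks of other indices are zero. *)
Lemma hform_line_blocks A c n :
  hform (fun i j => A i j * (g n (dot (xi i) (xi j)))%:C%C) c c =
  \sum_k \sum_l hform A (line_coef xi c n k) (line_coef xi c n l) *
                (g n (dot (xi k) (xi l)))%:C%C.
Proof.
rewrite [RHS](_ : _ = \sum_i \sum_j \sum_k \sum_l
   line_coef xi c n k i * (line_coef xi c n l j)^* * A i j *
   (g n (dot (xi k) (xi l)))%:C%C); last first.
  under eq_bigr do under eq_bigr do rewrite /hform mulr_suml.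
  under eq_bigr do under eq_bigr do under eq_bigr do rewrite mulr_suml.
  under eq_bigr do rewrite exchange_big /=.
  rewrite exchange_big /=; apply: eq_bigr => i _.
  under eq_bigr do rewrite exchange_big /=.
  by rewrite exchange_big.
apply: eq_bigr => i _; apply: eq_bigr => j _.
under eq_bigr => k _.
  rewrite (eq_bigr (fun l => line_coef xi c n k i * (c j * (line_sign xi j ^+ n)%:C%C)^*
     * A i j * (g n (dot (xi k) (xi l)))%:C%C * (line_rep xi j == l)%:R)).
    rewrite (sum_delta (fun l => _ * (g n (dot (xi k) (xi l)))%:C%C)).
    over.
  by move=> l _; rewrite /line_coef !rmorphM /= conjC_nat; ring.
rewrite (eq_bigr (fun k => c i * (line_sign xi i ^+ n)%:C%C *
   (c j * (line_sign xi j ^+ n)%:C%C)^*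
     * A i j * (g n (dot (xi k) (xi (line_rep xi j))))%:C%C * (line_rep xi i == k)%:R)).
  rewrite (sum_delta (fun k => _ * (g n (dot (xi k) _))%:C%C)).
  rewrite {1}(line_signE xi1 i) {1}(line_signE xi1 j) dotZl dotZr.
  rewrite !zonal_hat_sign ?line_sign_sqr// !rmorphM /= conj_real_complex; ring.
by move=> k _; rewrite /line_coef; ring.
Qed.

(** The bound on [e] lets [diag_dominance] keep at least half of the sum of the diagonal blocks, of
    which block [k] is positive and the others are nonnegative. *)
Lemma hform_lines_gt0 A c n e k : psd A -> 0 <= e -> e * m%:R <= 1 / 2 ->
  (forall i j, dot (xi i) (xi j) ^+ 2 < 1 -> `|g n (dot (xi i) (xi j))| <= e) ->
  0 < hform A (line_coef xi c n k) (line_coef xi c n k) ->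
  0 < hform (fun i j => A i j * (g n (dot (xi i) (xi j)))%:C%C) c c.
Proof.
move=> Apsd e0 em ge; rewrite !complex_gt0E => /andP[_ Bk].
have := psd_zonal_hat n d_ge3 xi1 Apsd c.
rewrite complex_ge0E => /andP[-> _] /=.
rewrite hform_line_blocks Re_sum.
under eq_bigr do rewrite Re_sum.
under eq_bigr do under eq_bigr do rewrite ReMr mulrC.
pose C := line_coef xi c n; pose b i j := complex.Re (hform A (C i) (C j)).
have bP i j : `|b i j + b j i| <= b i i + b j j by exact: psd_cross_le.
have bkk i : 0 <= b i i.
  by have := Apsd (C i); rewrite complex_ge0E => /andP[].
apply: (@lt_le_trans _ _ ((1 - e * m%:R) * \sum_i b i i)).
  rewrite mulr_gt0//; first by lra.
  by rewrite (bigD1 k)//= ltr_wpDr// sumr_ge0.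
apply: diag_dominance => //.
- by move=> i j; rewrite dotC.
- by move=> i; rewrite dot_unit_norm// zonal_hat_at1.
move=> i j ij; have := dot_unit_sqr_le1 (xi1 i) (xi1 j).
rewrite le_eqVlt => /predU1P[dij|/ge]; last by left.
(* Two distinct indices on one line cannot both be representatives, and the block of a
   non-representative is zero. *)
have C0 l : line_rep xi l != l -> forall a, C l a = 0.
  move=> ll a; rewrite /C /line_coef; case: eqP => [al|_]; last by rewrite mulr0.
  by case/eqP: ll; rewrite -al line_rep_rep.
right; have [ii|/C0 Ci] := eqVneq (line_rep xi i) i; last first.
  by rewrite /b hform0l// hform0r// addr0.
have [jj|/C0 Cj] := eqVneq (line_rep xi j) j; last first.
  by rewrite /b hform0r// hform0l// addr0.
by case/eqP: ij; rewrite -ii -jj; exact: line_rep_eq.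
Qed.

End LineBlocks.

Lemma infinite_set_ge (S : set nat) N : infinite_set S -> exists2 n, S n & (N <= n)%N.
Proof.
move=> Sinf; apply: contrapT => noN; apply: Sinf.
apply: sub_finite_set (finite_II N) => n Sn /=; rewrite ltnNge; apply/negP => Nn.
by apply: noN; exists n.
Qed.

Lemma finite_set_lt (S : set nat) : finite_set S ->
  exists N, forall n, S n -> (n < N)%N.
Proof.
move=> /finite_seqP[s ->]; exists (\max_(i <- s) i).+1 => n /= ns.
by rewrite ltnS; exact: (@leq_bigmax_seq _ s xpredT id).
Qed.

Lemma uniform_eventually (I : finType) (Q : I -> nat -> Prop) :
  (forall i, exists N, forall n, (N <= n)%N -> Q i n) ->
  exists N, forall i n, (N <= n)%N -> Q i n.
Proof.
move=> /choice[N NP]; exists (\max_i N i) => i n Nn.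
exact: NP (leq_trans (leq_bigmax i) Nn).
Qed.

Section MergeRadii.
Variables (R : realType) (m : nat) (r : 'I_m -> R) (P : pred 'I_m).

Let s := undup [seq r i | i <- enum P].

Let rr (a : 'I_(size s)) : R := nth 0 s a.

(** Points that share a radius, such as two opposite ones, are merged and their coefficients added,
    so that a hypothesis about distinct radii applies. The predicate [P] will select the nonzero
    points, which makes all [rho a] positive. *)
Lemma merge_radii : exists (M : nat) (rho : 'I_M -> R), [/\ injective rho,
  (forall a, exists2 i, P i & rho a = r i),
  (forall i, P i -> exists a, rho a = r i) &
  forall c : 'I_m -> R[i], (forall i, ~~ P i -> c i = 0) ->
    forall A, hform (fun i j => A (r i) (r j)) c c =
      qform A rho (fun a => \sum_(i | r i == rho a) c i)].
Proof.
have rr_inj : injective rr.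
  move=> a b /eqP; rewrite nth_uniq ?undup_uniq// => /eqP; exact: val_inj.
have rrP i : P i -> exists a, rr a = r i.
  move=> Pi; have ri : r i \in s by rewrite mem_undup map_f// mem_enum.
  have si : (index (r i) s < size s)%N by rewrite index_mem.
  by exists (Ordinal si); rewrite /rr /= nth_index.
exists (size s), rr; split => //.
  move=> a; have : rr a \in s by rewrite mem_nth.
  by rewrite mem_undup => /mapP[j]; rewrite mem_enum => Pj ra; exists j.
move=> c c0 A.
have sumE (G : R -> R[i]) :
    \sum_i c i * G (r i) = \sum_a (\sum_(i | r i == rr a) c i) * G (rr a).
  under [RHS]eq_bigr do rewrite mulr_suml.
  rewrite (exchange_big_dep xpredT)//=; apply: eq_bigr => i _.
  have [Pi|/c0 ci] := boolP (P i); last first.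
    by rewrite ci mul0r big1// => a _; rewrite mul0r.
  have [a ra] := rrP i Pi; rewrite (big_pred1 a) ?ra// => b.
  by rewrite -ra (inj_eq rr_inj) eq_sym.
rewrite /hform /qform.
under eq_bigr => i _.
  under eq_bigr do rewrite -mulrA.
  rewrite -mulr_sumr.
  rewrite [\sum_j _](_ : _ = (\sum_j c j * (A (r i) (r j))^*)^*); last first.
    by rewrite rmorph_sum; apply: eq_bigr => j _; rewrite rmorphM /= conjCK.
  rewrite (sumE (fun y => (A (r i) y)^*)); over.
rewrite (sumE (fun z => (\sum_a (\sum_(i | r i == rr a) c i) * (A z (rr a))^*)^*)).
apply: eq_bigr => a _; rewrite rmorph_sum mulr_sumr; apply: eq_bigr => b _.
by rewrite rmorphM /= conjCK mulrA.
Qed.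

End MergeRadii.

Lemma eq_hform_support (R : realType) m (A : 'I_m -> 'I_m -> R[i])
    (c c' : 'I_m -> R[i]) :
  (forall i, c i = c' i \/ forall j, A i j = 0 /\ A j i = 0) ->
  hform A c c = hform A c' c'.
Proof.
move=> cP; apply: eq_bigr => i _; apply: eq_bigr => j _.
have [->|/(_ j)[-> _]] := cP i; last by rewrite !mulr0.
by have [->//|/(_ i)[_ ->]] := cP j; rewrite !mulr0.
Qed.

(** * Equivalence of the conditions *)

Section Kernel.
Variables (R : realType) (d : dimension).
Hypothesis d_ge3 : dim_ge3 d.
Variable K : Rd R d -> Rd R d -> R[i].
Variable alpha : nat -> R -> R -> R[i].
Hypothesis alphaP : associated_kernels K alpha.
Local Notation g := (@zonal_hat R d).

Lemma alpha_psd n m (r : 'I_m -> R) : (forall i, 0 <= r i) ->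
  psd (fun i j => alpha n (r i) (r j)).
Proof.
move=> r0 c; apply: (associated_posdef alphaP n) => i.
by rewrite /= in_itv /= r0.
Qed.

Lemma unit_vector : exists e : Rd R d, `|e| = 1.
Proof.
have [e [_ [e1 _ _]]] := Rd_orthonormal R d_ge3; exists e.
by apply/eqP; rewrite -(@eqrXn2 _ 2)// expr1n -dotxx e1.
Qed.

(* At the origin the value [e] is immaterial: [alpha n] vanishes there for
   [n > 0] and the polynomial of degree 0 is constant. *)
Definition direction (e x : Rd R d) : Rd R d := if x == 0 then e else `|x|^-1 *: x.

Lemma norm_direction e x : `|e| = 1 -> `|direction e x| = 1.
Proof.
by move=> e1; rewrite /direction; case: eqVneq => // ?; exact: norm_normalize.
Qed.

Lemma directionE e x : `|x| *: direction e x = x.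
Proof.
rewrite /direction; case: eqVneq => [->|x0]; first by rewrite normr0 scale0r.
by rewrite scalerA divff ?scale1r// normr_eq0.
Qed.

Lemma kernel_expansion e x y : `|e| = 1 ->
  series (fun n => alpha n `|x| `|y| *
    (g n (dot (direction e x) (direction e y)))%:C%C) @ \oo --> K x y.
Proof.
move=> e1; have [xy0|/not_orP[/eqP x0 /eqP y0]] := pselect (x = 0 \/ y = 0).
  rewrite (associated_origin alphaP xy0); apply: cvg_near_cst.
  exists 1%N => // -[//|n] _; rewrite /series /= big_nat_recl//= big1 ?addr0 ?mulr1//.
  move=> i _; have [x0 y0] := (normr_ge0 x, normr_ge0 y).
  have [_ Ax] := associated_zero alphaP (ltn0Sn i) y0.
  have [Ay _] := associated_zero alphaP (ltn0Sn i) x0.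
  by case: xy0 => ->; rewrite normr0 ?Ax ?Ay mul0r.
rewrite [X in series X @ \oo](_ : _ = fun n => alpha n `|x| `|y| *
    (gegenbauer_hat (lambda d) n (dot (`|x|^-1 *: x) (`|y|^-1 *: y)))%:C%C).
  exact: (associated_expansion alphaP).
apply/funext => n; rewrite gegenbauer_hat_lambda//.
  by rewrite /direction (negbTE x0) (negbTE y0).
by apply: dot_unit_sqr_le1; exact: norm_normalize.
Qed.

Lemma qform_expansion e m (x : 'I_m -> Rd R d) c : `|e| = 1 ->
  series (fun n => hform (fun i j => alpha n `|x i| `|x j| *
    (g n (dot (direction e (x i)) (direction e (x j))))%:C%C) c c) @ \oo -->
  qform K x c.
Proof.
move=> e1; rewrite [X in X @ \oo](_ : _ = fun N => \sum_i \sum_j c i * (c j)^* *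
    series (fun n => alpha n `|x i| `|x j| *
    (g n (dot (direction e (x i)) (direction e (x j))))%:C%C) N).
  apply: cvg_sum_complex => i; apply: cvg_sum_complex => j; apply: cvgMl_tmp.
  exact: kernel_expansion.
apply/funext => N; rewrite /series /= /hform exchange_big /=.
apply: eq_bigr => i _; rewrite exchange_big; apply: eq_bigr => j _ /=.
by rewrite mulr_sumr.
Qed.

Lemma expansion_term_ge0 e m (x : 'I_m -> Rd R d) c n : `|e| = 1 ->
  0 <= hform (fun i j => alpha n `|x i| `|x j| *
    (g n (dot (direction e (x i)) (direction e (x j))))%:C%C) c c.
Proof.
move=> e1; apply: (psd_zonal_hat n d_ge3) => [i|]; first exact: norm_direction.
by apply: alpha_psd.
Qed.

Lemma qform_gt0 e m (x : 'I_m -> Rd R d) c n : `|e| = 1 ->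
  0 < hform (fun i j => alpha n `|x i| `|x j| *
    (g n (dot (direction e (x i)) (direction e (x j))))%:C%C) c c ->
  0 < qform K x c.
Proof.
move=> e1 tn; apply: (@cvg_series_gt0 _ _ _ n _ (@qform_expansion e m x c e1) tn).
by move=> k; exact: expansion_term_ge0.
Qed.

Lemma forms_positive_qform_gt0 m (x : 'I_m -> Rd R d) c i0 :
  forms_positive_infinitely_often alpha -> injective x ->
  x i0 != 0 -> c i0 != 0 -> 0 < qform K x c.
Proof.
move=> apos x_inj xi0 ci0; have [e e1] := unit_vector.
pose xi i := direction e (x i); pose r i := `|x i|.
have xi1 i : `|xi i| = 1 by exact: norm_direction.
(* Coefficients at the origin are dropped; they do not contribute in positive degree. *)
pose c0 i := if x i == 0 then 0 else c i.
pose P : pred 'I_m := fun i => x i != 0.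
pose k0 := line_rep xi i0.
have [M [rho [rho_inj rhoP Prho rhoE]]] := merge_radii r P.
have [a0 ra0] := Prho i0 xi0.
pose S (p : bool) := \sum_(i | r i == rho a0) line_coef xi c0 p k0 i.
have S_neq0 : exists p, S p != 0.
  apply: contrapT => noS.
  have S0 p : S p = 0 by apply/eqP; apply: contrapT => /negP Sp; apply: noS; exists p.
  (* [S p] is the merged coefficient at the radius of [x i0] on its line, for parity [p]. Only
     [x i0] and possibly [- x i0] lie there; the combination doubles the coefficient of the first
     and cancels that of the second, whose sign is opposite. *)
  have : S false + (line_sign xi i0)%:C%C * S true = 2 * c i0.
    rewrite /S mulr_sumr -big_split (bigD1 i0)/= ?ra0// big1 ?addr0 => [|i /andP[]].
      rewrite /line_coef /= eqxx expr0 expr1 !mulr1 /c0 (negbTE xi0).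
      by rewrite mulrCA -rmorphM /= -expr2 line_sign_sqr// mulr1 mulr2n mulrDl mul1r.
    move=> /eqP rii0 ii0; rewrite /line_coef /=.
    case: eqP => [ik|_]; last by rewrite !mulr0 addr0.
    rewrite expr0 expr1 !mulr1 mulrCA -rmorphM /=.
    have [ss|ss] := eqVneq (line_sign xi i) (line_sign xi i0).
      case/eqP: ii0; apply: x_inj.
      rewrite -(directionE e (x i)) -(directionE e (x i0)) -/(xi i) -/(xi i0).
      rewrite (line_signE xi1 i) (line_signE xi1 i0) ss ik -/k0; congr (_ *: _).
      by rewrite -/(r i) rii0.
    have -> : line_sign xi i0 * line_sign xi i = -1.
      have /eqP := line_sign_sqr xi1 i; have /eqP := line_sign_sqr xi1 i0.
      rewrite !sqrf_eq1 => /orP[]/eqP s0 /orP[]/eqP s; move: ss; rewrite s0 s ?eqxx//.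
        by rewrite mul1r.
      by rewrite mulr1.
    by rewrite rmorphN rmorph1 mulrN1 subrr.
  rewrite !S0 mulr0 addr0 => /esym/eqP; rewrite mulf_eq0 pnatr_eq0 /=.
  by rewrite (negbTE ci0).
have [p Sp] := S_neq0.
have m_gt0 : 0 < m%:R :> R by rewrite ltr0n; apply: leq_ltn_trans (ltn_ord i0).
pose eps : R := 1 / 2 / m%:R.
have eps0 : 0 < eps by rewrite !divr_gt0.
have [N NP] : exists N, forall ij n, (N <= n)%N ->
    dot (xi ij.1) (xi ij.2) ^+ 2 < 1 -> `|g n (dot (xi ij.1) (xi ij.2))| <= eps.
  apply: (@uniform_eventually ('I_m * 'I_m)%type (fun ij n =>
    dot (xi ij.1) (xi ij.2) ^+ 2 < 1 -> `|g n (dot (xi ij.1) (xi ij.2))| <= eps)).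
  move=> ij.
  have [lt1|nlt1] := ltP (dot (xi ij.1) (xi ij.2) ^+ 2) 1; last by exists 0%N.
  by have [N NP] := zonal_hat_cvg0 d_ge3 lt1 eps0; exists N => n /NP.
have rho_gt0 a : 0 < rho a.
  by have [i Pi ->] := rhoP a; rewrite normr_gt0.
pose c' a := \sum_(i | r i == rho a) line_coef xi c0 p k0 i.
have c'_neq0 : exists a, c' a != 0 by exists a0.
have [even_inf odd_inf] := apos M rho c' rho_gt0 rho_inj c'_neq0.
(* Besides being large enough for the decay, [n] is at least 1, so that [alpha n] vanishes when one
   point is the origin. *)
have [n [n_odd n_ge n_pos]] : exists n, [/\ odd n = p, (maxn N 1 <= n)%N &
    0 < qform (alpha n) rho c'].
  move: (c') even_inf odd_inf => w even_inf odd_inf; case: (p).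
    by have [n [npos /= nodd] nN] := infinite_set_ge (maxn N 1) odd_inf; exists n.
  have [n [npos /= /negbTE nodd] nN] := infinite_set_ge (maxn N 1) even_inf.
  by exists n.
move: n_ge; rewrite geq_max => /andP[nN n1].
apply: (@qform_gt0 e _ _ _ n e1).
rewrite (@eq_hform_support _ _ _ _ c0); last first.
  move=> i; rewrite /c0; case: eqVneq => [xi_0|_]; [right => j|by left].
  have [A0 A1] := associated_zero alphaP n1 (normr_ge0 (x j)).
  by rewrite xi_0 normr0 A0 A1 !mul0r.
apply: (@hform_lines_gt0 R d m xi d_ge3 xi1 _ c0 n eps k0).
- by apply: alpha_psd => i; exact: normr_ge0.
- exact: ltW.
- by rewrite /eps divfK ?gt_eqF.
- by move=> i j; exact: (NP (i, j) n nN).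
move: n_pos; rewrite -(rhoE (line_coef xi c0 p k0)) => [|i]; last first.
  by rewrite negbK => /eqP x0; rewrite /line_coef /c0 x0 eqxx !mul0r.
congr (0 < hform _ _ _); apply/funext => i;
  by rewrite /line_coef [in RHS](line_sign_exp xi1) n_odd.
Qed.

End Kernel.

Lemma sum_pair_mul (A : comNzRingType) (I J : finType)
    (P : I -> I -> A) (Q : J -> J -> A) :
  \sum_(x : I * J) \sum_(y : I * J) P x.1 y.1 * Q x.2 y.2 =
  (\sum_i \sum_i' P i i') * (\sum_j \sum_j' Q j j').
Proof.
rewrite -(pair_bigA _ (fun i j => \sum_(y : I * J) P i y.1 * Q j y.2)) /=.
rewrite mulr_suml; apply: eq_bigr => i _.
under eq_bigr => j _ do
  rewrite -(pair_bigA _ (fun i' j' => P i i' * Q j j')) /=.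
rewrite exchange_big mulr_suml; apply: eq_bigr => i' _ /=.
by rewrite mulr_sumr; apply: eq_bigr => j _; rewrite mulr_sumr.
Qed.

Lemma strict_posdef_fin (R : realType) (X : Type) (A : set X) (K : X -> X -> R[i])
    (I : finType) (x : I -> X) (c : I -> R[i]) :
  strict_posdef_on A K -> (forall i, A (x i)) -> injective x ->
  (exists i, c i != 0) -> 0 < \sum_i \sum_j c i * (c j)^* * K (x i) (x j).
Proof.
move=> Kpos Ax x_inj [i ci].
have bij : {on xpredT, bijective (@enum_val I I)} by exact: onW_bij (enum_val_bij I).
rewrite (reindex (@enum_val I I))//=.
under eq_bigr do rewrite (reindex (@enum_val I I))//=.
apply: (Kpos #|I| (fun a => x (enum_val a)) (fun a => c (enum_val a))) => //.
  by move=> a b /x_inj /enum_val_inj.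
by exists (enum_rank i); rewrite enum_rankK.
Qed.

(** * Points on a circle *)

Section CirclePoints.
Variables (R : realType) (V : innerProdType R) (e1 e2 : V).
Hypotheses (e11 : dot e1 e1 = 1) (e22 : dot e2 e2 = 1) (e12 : dot e1 e2 = 0).

(** All these vectors have component 1 along [e1], so after normalisation they are distinct points
    of an open half circle, no two of them opposite. *)
Let vec (k : nat) : V := e1 + k%:R *: e2.

Definition circle_point (k : nat) : V := `|vec k|^-1 *: vec k.

Let dot_vec1 k : dot (vec k) e1 = 1.
Proof. by rewrite dotDl dotZl (dotC e2) e11 e12 mulr0 addr0. Qed.

Let dot_vec2 k : dot (vec k) e2 = k%:R.
Proof. by rewrite dotDl dotZl e22 e12 mulr1 add0r. Qed.

Let norm_vec_gt0 k : 0 < `|vec k|.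
Proof.
rewrite normr_gt0; apply/eqP => vk0; have := dot_vec1 k.
by rewrite vk0 -(scale0r e1) dotZl mul0r => /eqP; rewrite eq_sym oner_eq0.
Qed.

Lemma norm_circle_point k : `|circle_point k| = 1.
Proof. by apply: norm_normalize; rewrite -normr_gt0. Qed.

Lemma dot_circle_point k l : dot (circle_point k) (circle_point l) =
  `|vec k|^-1 * `|vec l|^-1 + (`|vec k|^-1 * k%:R) * (`|vec l|^-1 * l%:R).
Proof.
rewrite dotZl dotZr [dot (vec k) _]dotDr dotZr dot_vec1 dot_vec2; ring.
Qed.

Lemma finite_rank_circle :
  finite_rank (fun k l => dot (circle_point k) (circle_point l)).
Proof.
have f1 := @finite_rank_prod R nat (fun k => `|vec k|^-1) (fun k => `|vec k|^-1).
have f2 := @finite_rank_prod R nat (fun k => `|vec k|^-1 * k%:R)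
  (fun k => `|vec k|^-1 * k%:R).
have [I [f [g fg]]] := finite_rankD f1 f2.
by exists I, f, g => k l; rewrite -fg dot_circle_point.
Qed.

(** The norm determines the radius, the component along [e1] the sign, and the ratio of the two
    components the index. *)
Lemma circle_point_inj (r s : R) (b b' : bool) k l : 0 < r -> 0 < s ->
  ((-1) ^+ b * r) *: circle_point k = ((-1) ^+ b' * s) *: circle_point l ->
  [/\ r = s, b = b' & k = l].
Proof.
move=> r0 s0 E; have rs : r = s.
  have := congr1 Num.norm E; rewrite [LHS]normrZ [RHS]normrZ !norm_circle_point !mulr1.
  by rewrite !normrM !normrX !normrN1 !expr1n !mul1r !gtr0_norm.
have E1 := congr1 (fun v => dot v e1) E; have E2 := congr1 (fun v => dot v e2) E.
rewrite /= !dotZl !dot_vec1 !dot_vec2 !mulr1 in E1 E2.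
have k0 := norm_vec_gt0 k; have l0 := norm_vec_gt0 l.
have bb : b = b'.
  have pos (t : bool) (u : R) v : 0 < u -> 0 < v ->
      (0 < (-1) ^+ t * u * v^-1) = ~~ t.
    move=> u0 v0; rewrite pmulr_lgt0 ?invr_gt0// pmulr_lgt0//.
    by case: t; rewrite ?expr0 ?expr1 ?ltr01 ?ltr0N1.
  by have := pos b r _ r0 k0; rewrite E1 pos//; case: (b) (b') => -[].
split=> //; apply/eqP; rewrite -(eqr_nat R); apply/eqP.
have a0 : (-1) ^+ b * r * `|vec k|^-1 != 0.
  by rewrite !mulf_neq0 ?signr_eq0 ?gt_eqF// invr_gt0.
by apply: (mulfI a0); rewrite -[LHS]mulrA E2 [LHS]mulrA -E1.
Qed.

End CirclePoints.

(** * Strict positive definiteness with and without the origin *)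

Section Equivalences.
Variables (R : realType) (d : dimension).
Hypothesis d_ge3 : dim_ge3 d.
Variable K : Rd R d -> Rd R d -> R[i].
Variable alpha : nat -> R -> R -> R[i].
Hypothesis alphaP : associated_kernels K alpha.
Local Notation g := (@zonal_hat R d).

Lemma forms_positive_strict : forms_positive_infinitely_often alpha ->
  strict_posdef_on [set~ 0] K.
Proof.
move=> apos m x c x0 x_inj [i ci].
by apply: (forms_positive_qform_gt0 d_ge3 alphaP (i0 := i)) => //; exact/eqP/x0.
Qed.

Lemma forms_positive_strictT : 0 < alpha 0 0 0 ->
  forms_positive_infinitely_often alpha -> strict_posdef_on setT K.
Proof.
move=> a0 apos m x c _ x_inj [i ci].
(* Either some nonzero point carries a nonzero coefficient, or the only nonzero coefficient sits at
   the origin, where [alpha 0 0 0] decides. *)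
have [[j [xj cj]]|noj] := pselect (exists j, x j != 0 /\ c j != 0).
  by apply: (forms_positive_qform_gt0 d_ge3 alphaP (i0 := j)).
have xi : x i = 0.
  by apply/eqP; apply: contrapT => /negP xi; apply: noj; exists i.
have c0 j : j != i -> c j = 0.
  move=> ji; apply/eqP; apply: contrapT => /negP cj; apply: noj; exists j.
  by split => //; apply: contra ji => /eqP xj; apply/eqP/x_inj; rewrite xj xi.
rewrite /qform (bigD1 i)//= [X in _ + X]big1 ?addr0 => [|j ji]; last first.
  by rewrite big1// => k _; rewrite (c0 j ji) !mul0r.
rewrite (bigD1 i)//= big1 ?addr0 => [|k ki]; last first.
  by rewrite (c0 k ki) rmorph0 mulr0 mul0r.
rewrite (associated_origin alphaP) ?xi ?normr0; last by left.
by rewrite mulr_gt0// mul_conjC_gt0.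
Qed.

Lemma strict_origin_gt0 : strict_posdef_on setT K -> 0 < alpha 0 0 0.
Proof.
move=> Kpos; have := Kpos 1%N (fun=> 0) (fun=> 1) (fun=> Logic.I).
have inj1 : injective (fun _ : 'I_1 => (0 : Rd R d)).
  by move=> i j _; rewrite !ord1.
move=> /(_ inj1 (ex_intro _ 0 (oner_neq0 _))).
rewrite /qform !big_ord1 rmorph1 !mul1r.
by rewrite (associated_origin alphaP) ?normr0//; left.
Qed.

Lemma strict_subset (A B : set (Rd R d)) : A `<=` B -> strict_posdef_on B K ->
  strict_posdef_on A K.
Proof. by move=> AB Kpos m x c Ax; apply: Kpos => i; apply: AB. Qed.

Lemma alpha_form_ge0 n m (r : 'I_m -> R) c : (forall i, 0 < r i) ->
  0 <= qform (alpha n) r c.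
Proof. by move=> r0; apply: (alpha_psd alphaP) => i; exact: ltW. Qed.

Lemma alpha_form_eq0 n m (r : 'I_m -> R) c : (forall i, 0 < r i) ->
  ~ (0 < qform (alpha n) r c) -> qform (alpha n) r c = 0.
Proof.
move=> r0 np; have := alpha_form_ge0 n c r0.
by rewrite le_eqVlt => /predU1P[<-//|].
Qed.

Lemma zonal_hat_signs n (b b' : bool) t :
  g n ((-1) ^+ b * ((-1) ^+ b' * t)) = ((-1) ^+ n) ^+ b * (((-1) ^+ n) ^+ b' * g n t).
Proof.
by rewrite !zonal_hat_sign ?sqrr_sign// (exprAC _ b n) (exprAC _ b' n).
Qed.

Lemma polar_expansion (r s : R) (x y : Rd R d) :
  0 < r -> 0 < s -> `|x| = 1 -> `|y| = 1 -> forall b b' : bool,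
  series (fun n => alpha n r s *
    (((-1) ^+ n) ^+ b * (((-1) ^+ n) ^+ b' * g n (dot x y)))%:C%C) @ \oo -->
  K (((-1) ^+ b * r) *: x) (((-1) ^+ b' * s) *: y).
Proof.
move=> r0 s0 x1 y1 b b'.
have normE (t : R) (z : Rd R d) (a : bool) : 0 < t -> `|z| = 1 ->
    `|((-1) ^+ a * t) *: z| = t.
  move=> t0 z1; rewrite normrZ z1 mulr1 normrM normrX normrN1 expr1n mul1r.
  by rewrite gtr0_norm.
have neq0 (t : R) (z : Rd R d) (a : bool) : 0 < t -> `|z| = 1 ->
    ((-1) ^+ a * t) *: z != 0.
  by move=> t0 z1; rewrite -normr_gt0 normE.
have dirE (t : R) (z : Rd R d) (a : bool) : 0 < t -> `|z| = 1 ->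
    direction x (((-1) ^+ a * t) *: z) = (-1) ^+ a *: z.
  move=> t0 z1; rewrite /direction (negbTE (neq0 _ _ _ t0 z1)) normE//.
  by rewrite scalerA mulrC mulfK// gt_eqF.
have := @kernel_expansion R d d_ge3 K alpha alphaP x
  (((-1) ^+ b * r) *: x) (((-1) ^+ b' * s) *: y) x1.
rewrite !normE// !dirE// dotZl dotZr.
rewrite (_ : (fun n => _) = fun n => alpha n r s *
    (((-1) ^+ n) ^+ b * (((-1) ^+ n) ^+ b' * g n (dot x y)))%:C%C)//.
by apply/funext => n; rewrite zonal_hat_signs.
Qed.

(** Suppose that positive forms of parity [p] occur only below [N]. The weights [w] kill these
    degrees, the signs [tau] kill the other parity, and in the remaining degrees the form of
    [alpha n] is zero, against strictness. *)
Lemma strict_forms_parity (p : bool) m (r : 'I_m -> R) c :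
  strict_posdef_on [set~ 0] K ->
  (forall i, 0 < r i) -> injective r -> (exists i, c i != 0) ->
  infinite_set ([set n | 0 < qform (alpha n) r c] `&` [set n | odd n = p]).
Proof.
move=> Kpos r0 r_inj [i0 ci0] /finite_set_lt[N NP].
have [e1 [e2 [e11 e22 e12]]] := Rd_orthonormal R d_ge3.
pose xi := circle_point e1 e2.
have xi1 k : `|xi k| = 1 by exact: norm_circle_point.
have [M [w [[k0 wk0] w0]]] := @exists_annihilator R
  (fun n k l => g n (dot (xi k) (xi l))) N
  (fun n => finite_rank_three_term (zonal_mu R d) n (finite_rank_circle e11 e22 e12)).
pose G n k l := g n (dot (xi k) (xi l)).
pose tau (b : bool) : R[i] := ((-1) ^+ b) ^+ p.
have tau_neq0 b : tau b != 0 by rewrite expf_neq0// signr_eq0.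
have tau_conj b : (tau b)^* = tau b by rewrite /tau rmorphXn /= rmorph_sign.
pose x (a : 'I_M * 'I_m * bool) := ((-1) ^+ a.2 * r a.1.2) *: xi a.1.1.
pose C (a : 'I_M * 'I_m * bool) : R[i] := (w a.1.1)%:C%C * c a.1.2 * tau a.2.
have x_inj : injective x.
  move=> [[k i] b] [[l j] b'] /(circle_point_inj e11 e22 e12 (r0 i) (r0 j)) /=.
  by move=> [/r_inj -> -> /val_inj ->].
have x_neq0 a : [set~ 0] (x a).
  move=> /eqP; rewrite scaler_eq0 mulf_eq0 signr_eq0 gt_eqF//= -normr_eq0 xi1.
  by rewrite oner_eq0.
have C_neq0 : exists a, C a != 0.
  exists (k0, i0, true); rewrite !mulf_neq0//.
  by rewrite (inj_eq (@complexI R) _ 0).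
have := strict_posdef_fin Kpos x_neq0 x_inj C_neq0.
suff -> : \sum_a \sum_a' C a * (C a')^* * K (x a) (x a') = 0 by rewrite ltxx.
pose T n b : R[i] := tau b * (((-1) ^+ n) ^+ b).
pose t n a a' : R[i] := C a * (C a')^* * (alpha n (r a.1.2) (r a'.1.2) *
   (((-1) ^+ n) ^+ a.2 * (((-1) ^+ n) ^+ a'.2 * G n a.1.1 a'.1.1))%:C%C).
(* Each term of the expansion is a product of three factors, from the circle, the radii and the
   signs. *)
have tE n : \sum_a \sum_a' t n a a' =
   (\sum_k \sum_l w k * w l * G n k l)%:C%C *
   qform (alpha n) r c * (\sum_b T n b * \sum_b' T n b').
  rewrite [X in _ * X](_ : _ = \sum_b \sum_b' T n b * T n b'); last first.
    by apply: eq_bigr => b _; rewrite mulr_sumr.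
  rewrite rmorph_sum (eq_bigr (fun k => \sum_l (w k * w l * G n k l)%:C%C));
    last by move=> k _; rewrite /= rmorph_sum.
  rewrite -(sum_pair_mul (fun k l => (w k * w l * G n k l)%:C%C)
    (fun i j => c i * (c j)^* * alpha n (r i) (r j))).
  rewrite -(sum_pair_mul (fun a a' => (w a.1 * w a'.1 * G n a.1 a'.1)%:C%C *
    (c a.2 * (c a'.2)^* * alpha n (r a.2) (r a'.2))) (fun b b' => T n b * T n b')).
  apply: eq_bigr => a _; apply: eq_bigr => a' _; rewrite /t /C /T.
  rewrite !rmorphM /= conj_real_complex tau_conj !rmorphXn /= rmorphN1; ring.
have t0 n : \sum_a \sum_a' t n a a' = 0.
  rewrite tE; have [np|np] := eqVneq (odd n) p; last first.
    (* The two signs give [1 + (-1) ^+ (n + p)], which is 0 for opposite parities. *)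
    suff T0 : \sum_b T n b = 0 by rewrite T0 -mulr_suml T0 mul0r mulr0.
    rewrite big_bool /T /tau -(signr_odd _ n); case: (p) (odd n) np => -[]//= _;
      rewrite ?expr0 ?expr1 ?mulr1 ?mul1r; ring.
  have [nN|nN] := ltnP n N; first by rewrite w0// !mul0r.
  rewrite alpha_form_eq0 ?mulr0 ?mul0r// => npos.
  by have := NP n (conj npos np); rewrite ltnNge nN.
apply: (@cvg_series0 _ (fun n => \sum_a \sum_a' t n a a')) => //.
rewrite [X in X @ \oo](_ : _ = fun N => \sum_a \sum_a' C a * (C a')^* *
   series (fun n => alpha n (r a.1.2) (r a'.1.2) *
   (((-1) ^+ n) ^+ a.2 * (((-1) ^+ n) ^+ a'.2 * G n a.1.1 a'.1.1))%:C%C) N).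
  apply: cvg_sum_complex => a; apply: cvg_sum_complex => a'; apply: cvgMl_tmp.
  exact: polar_expansion.
apply/funext => n; rewrite /series /= exchange_big; apply: eq_bigr => a _ /=.
by rewrite exchange_big; apply: eq_bigr => a' _ /=; rewrite mulr_sumr.
Qed.

Lemma odd_falseE : [set n | odd n = false] = [set n | ~~ odd n].
Proof. by apply/seteqP; split => n /=; [move=> ->|move/negbTE]. Qed.

Lemma strict_forms_positive : strict_posdef_on [set~ 0] K ->
  forms_positive_infinitely_often alpha.
Proof.
move=> Kpos m r c r0 r_inj c0; split; last exact: (@strict_forms_parity true).
by rewrite -odd_falseE; exact: strict_forms_parity.
Qed.

End Equivalences.

Lemma exists_nat_ge (R : realType) (x : R) : exists N : nat, x <= N%:R.
Proof.
exists (Num.bound `|x|); apply: le_trans (ler_norm x) _.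
exact: ltW (archi_boundP (normr_ge0 x)).
Qed.

(** * Sums over one parity *)

Section Tails.
Variables (R : realType) (d : dimension).
Hypothesis d_ge3 : dim_ge3 d.
Variable K : Rd R d -> Rd R d -> R[i].
Variable alpha : nat -> R -> R -> R[i].
Hypothesis alphaP : associated_kernels K alpha.
Local Notation g := (@zonal_hat R d).

Lemma infinite_often_forms_positive : infinitely_often_strict_posdef alpha ->
  forms_positive_infinitely_often alpha.
Proof.
move=> [even_inf odd_inf] m r c r0 r_inj c0.
have sub n : strict_posdef_on `]0, +oo[ (alpha n) -> 0 < qform (alpha n) r c.
  by apply => // i; rewrite /= in_itv /= r0.
split; [move: even_inf|move: odd_inf]; apply: contra_not;
  by apply: sub_finite_set => n [/sub].
Qed.

Definition alpha_parity (p : bool) (gamma r s : R) : R[i] :=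
  limn (fun N => \sum_(0 <= n < N | gamma <= (2 * n + p)%:R) alpha (2 * n + p)%N r s).

Lemma alpha_evenE gamma : alpha_even alpha gamma = alpha_parity false gamma.
Proof.
apply/funext => r; apply/funext => s; rewrite /alpha_even /alpha_parity.
by under [in RHS]eq_fun do under eq_bigl do rewrite addn0;
  under [in RHS]eq_fun do under eq_bigr do rewrite addn0.
Qed.

Lemma alpha_oddE gamma : alpha_odd alpha gamma = alpha_parity true gamma.
Proof. by []. Qed.

Lemma cvg_double : (fun n => (2 * n)%N) @ \oo --> \oo.
Proof. by move=> A [N _ NA]; exists N => // n /= Nn; apply: NA => /=; lia. Qed.

(* The even (odd) part of the expansion along a line is half the sum
   (difference) of the values of [K] at points on the same side and on
   opposite sides of the origin. *)
Lemma is_cvg_parity (p : bool) (r s : R) : 0 < r -> 0 < s ->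
  cvgn (fun N => \sum_(0 <= n < N) alpha (2 * n + p)%N r s).
Proof.
move=> r0 s0; have [e e1] := unit_vector R d_ge3.
have := polar_expansion d_ge3 alphaP r0 s0 e1 e1; rewrite dot_unit_norm// => pol.
pose u (b : bool) n := alpha n r s * ((((-1) ^+ n) ^+ b)%:C)%C.
have ucvg b :
    series (u b) @ \oo --> K (((-1) ^+ b * r) *: e) (((-1) ^+ false * s) *: e).
  have := pol b false; rewrite (_ : (fun n => _) = u b)//.
  by apply/funext => n; rewrite /u zonal_hat_at1 expr0 !mulr1.
have cvg2 b := cvg_comp _ _ cvg_double (ucvg b).
have uE b N : series (u b) (2 * N.+1)%N = series (u b) (2 * N)%N +
    (alpha (2 * N)%N r s + (-1) ^+ b * alpha (2 * N + 1)%N r s).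
  rewrite mulnS !addSn add0n /series /= !big_nat_recr//= -addrA; congr (_ + (_ + _)).
    by rewrite /u mulnC exprM sqrr_sign expr1n mulr1.
  rewrite /u addn1 exprS [in (2 * N)%N]mulnC exprM sqrr_sign mulr1.
  by rewrite rmorphXn /= rmorphN1 mulrC.
apply/cvg_ex; eexists.
rewrite [X in X @ \oo](_ : _ = fun N => 2^-1 * series (u false) (2 * N)%N
    + 2^-1 * (-1) ^+ p * series (u true) (2 * N)%N).
  by apply: cvgD; apply: cvgMl_tmp; exact: cvg2.
apply/funext; elim=> [|N IH].
  by rewrite muln0 /series /= !big_geq// !mulr0 addr0.
rewrite big_nat_recr//= IH !uE.
by case: p {IH} => /=; rewrite ?addn0 ?expr0 ?expr1; field.
Qed.

Lemma alpha_parity_cvg (p : bool) (gamma r s : R) : 0 < r -> 0 < s ->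
  (fun N => \sum_(0 <= n < N | gamma <= (2 * n + p)%:R) alpha (2 * n + p)%N r s)
    @ \oo --> alpha_parity p gamma r s.
Proof.
move=> r0 s0.
suff : cvgn (fun N => \sum_(0 <= n < N | gamma <= (2 * n + p)%:R)
                        alpha (2 * n + p)%N r s) by [].
(* [v] collects the terms removed by the cutoff; only finitely many are nonzero. *)
pose v n := if gamma <= (2 * n + p)%:R then 0 else alpha (2 * n + p)%N r s.
have vN : exists N0, forall n, (N0 <= n)%N -> v n = 0.
  have [N gN] := exists_nat_ge gamma; exists N => n Nn.
  by rewrite /v ifT// (le_trans gN)// ler_nat; lia.
have [N0 vN0] := vN.
have /cvg_ex[l lP] := @is_cvg_parity p r s r0 s0.
apply/cvg_ex; exists (l - \sum_(0 <= n < N0) v n).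
rewrite [X in X @ \oo](_ : _ = fun N => \sum_(0 <= n < N) alpha (2 * n + p)%N r s
    - \sum_(0 <= n < N) v n); last first.
  apply/funext => N; rewrite -sumrB big_mkcond; apply: eq_bigr => n _.
  by rewrite /v; case: ifP => _; rewrite ?subr0 ?subrr.
apply: cvgB; [exact: lP|apply: cvg_near_cst; exists N0 => // N /= N0N].
rewrite (big_cat_nat (leq0n N0) N0N) /= [X in _ + X]big1_seq ?addr0// => n /andP[_].
by rewrite mem_index_iota => /andP[/vN0].
Qed.

Lemma parity_form_cvg (p : bool) gamma m (r : 'I_m -> R) c : (forall i, 0 < r i) ->
  series (fun n =>
      if gamma <= (2 * n + p)%:R then qform (alpha (2 * n + p)%N) r c else 0)
    @ \oo --> qform (alpha_parity p gamma) r c.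
Proof.
move=> r0; rewrite [X in X @ \oo](_ : _ = fun N => \sum_i \sum_j c i * (c j)^* *
   \sum_(0 <= n < N | gamma <= (2 * n + p)%:R) alpha (2 * n + p)%N (r i) (r j)).
  apply: cvg_sum_complex => i; apply: cvg_sum_complex => j; apply: cvgMl_tmp.
  exact: alpha_parity_cvg.
apply/funext => N; rewrite /series /= -big_mkcond /= exchange_big /=.
apply: eq_bigr => i _; rewrite exchange_big /=; apply: eq_bigr => j _.
by rewrite mulr_sumr.
Qed.

(** One positive form of parity [p] in a degree beyond [gamma] makes the sum positive, all other
    terms being nonnegative. *)
Lemma parity_strict (p : bool) gamma :
  (forall m (r : 'I_m -> R) c, (forall i, 0 < r i) -> injective r ->
    (exists i, c i != 0) ->
    infinite_set ([set n | 0 < qform (alpha n) r c] `&` [set n | odd n = p])) ->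
  strict_posdef_on `]0, +oo[ (alpha_parity p gamma).
Proof.
move=> inf m r c rP r_inj c0.
have r0 i : 0 < r i by have := rP i; rewrite /= in_itv /= andbT.
have [N gN] := exists_nat_ge gamma.
have [n [npos np] Nn] := infinite_set_ge N (inf m r c r0 r_inj c0).
have nE : n = (2 * n./2 + p)%N by rewrite -np mul2n addnC odd_double_half.
apply: (@cvg_series_gt0 _ _ _ n./2 _ (@parity_form_cvg p gamma m r c r0)).
  by move=> k; case: ifP => // _; exact: (alpha_form_ge0 alphaP).
by rewrite -nE ifT// (le_trans gN)// ler_nat.
Qed.

(** If the positive forms stopped below [N], the sum cut off at [gamma = N] would have a vanishing
    form. *)
Lemma parity_strict_infinite (p : bool) m (r : 'I_m -> R) c :
  (forall gamma, 0 <= gamma -> strict_posdef_on `]0, +oo[ (alpha_parity p gamma)) ->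
  (forall i, 0 < r i) -> injective r -> (exists i, c i != 0) ->
  infinite_set ([set n | 0 < qform (alpha n) r c] `&` [set n | odd n = p]).
Proof.
move=> pos r0 r_inj c0 /finite_set_lt[N NP].
have : 0 < qform (alpha_parity p N%:R) r c.
  by apply: pos => // i; rewrite /= in_itv /= r0.
rewrite (cvg_series0 _ (@parity_form_cvg p N%:R m r c r0)) ?ltxx// => n.
case: ifP => //; rewrite ler_nat => Nn; apply: (alpha_form_eq0 alphaP) => // npos.
have np : odd (2 * n + p) = p by rewrite oddD oddM /=; case: (p).
by have := NP _ (conj npos np); rewrite ltnNge Nn.
Qed.

Lemma forms_positive_tails : forms_positive_infinitely_often alpha <->
  tails_strict_posdef alpha.
Proof.
split=> [apos gamma _|tails m r c r0 r_inj c0].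
  rewrite alpha_evenE alpha_oddE; split; apply: parity_strict => m r c r0 r_inj c0;
    have [even_inf odd_inf] := apos m r c r0 r_inj c0; last exact: odd_inf.
  by rewrite odd_falseE.
have evenP gamma : 0 <= gamma -> strict_posdef_on `]0, +oo[ (alpha_parity false gamma).
  by move=> /tails[]; rewrite alpha_evenE.
have oddP gamma : 0 <= gamma -> strict_posdef_on `]0, +oo[ (alpha_parity true gamma).
  by move=> /tails[_]; rewrite alpha_oddE.
split; last exact: (@parity_strict_infinite true).
by rewrite -odd_falseE; exact: parity_strict_infinite.
Qed.

End Tails.

Theorem theorem3p1 (R : realType) (d : dimension) (d_ge3 : dim_ge3 d)
    (K : Rd R d -> Rd R d -> R[i])
    (K_continuous : continuous (fun p : Rd R d * Rd R d => K p.1 p.2))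
    (K_isotropic : isotropic K)
    (K_posdef : posdef_on setT K)
    (alpha : nat -> R -> R -> R[i])
    (alphaP : associated_kernels K alpha) :
  [/\ strict_posdef_on setT K <->
        0 < alpha 0%N 0 0 /\ forms_positive_infinitely_often alpha,
      strict_posdef_on setT K <->
        0 < alpha 0%N 0 0 /\ tails_strict_posdef alpha,
      0 < alpha 0%N 0 0 /\ infinitely_often_strict_posdef alpha ->
        strict_posdef_on setT K,
      alpha 0%N 0 0 = 0 ->
        [/\ forms_positive_infinitely_often alpha ->
              strict_posdef_on [set~ 0] K,
            tails_strict_posdef alpha -> strict_posdef_on [set~ 0] K &
            infinitely_often_strict_posdef alpha ->
              strict_posdef_on [set~ 0] K] &
      strict_posdef_on [set~ 0] K ->
        forms_positive_infinitely_often alpha /\ tails_strict_posdef alpha].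
Proof.
(* Everything is routed through [forms_positive_infinitely_often]: it is equivalent to the condition
   on the tails and to strictness off the origin, and the whole space adds only the value at the
   origin. *)
have formsE := forms_positive_tails d_ge3 alphaP.
have formsT := forms_positive_strictT d_ge3 alphaP.
have forms0 := forms_positive_strict d_ge3 alphaP.
have forms_of0 := strict_forms_positive d_ge3 alphaP.
have origin := strict_origin_gt0 alphaP.
have strict0 : strict_posdef_on setT K -> strict_posdef_on [set~ 0] K.
  exact: strict_subset.
have iv := @infinite_often_forms_positive R alpha.
split.
- by split=> [KT|[a0 /(formsT a0)//]]; split; [exact: origin|exact/forms_of0/strict0].
- split=> [KT|[a0 /formsE/(formsT a0)//]].
  by split; [exact: origin|exact/formsE/forms_of0/strict0].
- by move=> [a0 /iv/(formsT a0)].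
- by move=> _; split=> [//|/formsE//|/iv].
- by move=> /forms_of0 apos; split => //; exact/formsE.
Qed.
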